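(* Let $(R,\mathfrak m)$ be a Cohen-Macaulay local ring of dimension two with infinite residue field and let $I,J$ be $\mathfrak m$-primary ideals of $R$. Then the following statements are equivalent: (a) $r(I^k|J^k)=0$ for all $k\gg0$; (b) $e_{(1,0)}=e_1(I)$, $e_{(0,1)}=e_1(J)$ and $e_2(IJ)=e_2(I)+e_2(J)$; (c) for every joint reduction $(a,b)$ of $I$ and $J$, $[H^2_{(at_1,bt_2)}(\mathcal R')]_{(0,0)}=0$.
   Context: $\ell$ denotes length of $R$-modules. $I^n=J^n=R$ for $n\le0$. A pair $(a,b)$ is a joint reduction of $I$ and $J$ if $a\in I$, $b\in J$ and $I^{r+1}J^{s+1}=aI^rJ^{s+1}+bI^{r+1}J^s$ for all large $r,s$. One writes $r(I|J)=0$ (joint reduction number zero) if there is a joint reduction $(a,b)$ of $I$ and $J$ with $IJ=aJ+bI$. $\mathcal R'=\bigoplus_{r,s\in\mathbb Z}I^rJ^st_1^rt_2^s\subseteq R[t_1^{\pm1},t_2^{\pm1}]$ is the bigraded extended Rees algebra; $H^2_{(at_1,bt_2)}(\mathcal R')$ is its second local cohomology module with support in the ideal $(at_1,bt_2)$, and $[\,\cdot\,]_{(r,s)}$ is the bigraded component. Hilbert coefficients: for an $\mathfrak m$-primary ideal $K$, $\ell(R/K^n)=e_0(K)\binom{n+1}{2}-e_1(K)n+e_2(K)$ for $n\gg0$. Bigraded Hilbert coefficients $e_{(i,j)}$ of $\{I^rJ^s\}$: $\ell(R/I^rJ^s)=\sum_{i+j\le 2}(-1)^{i+j}e_{(i,j)}\binom{r+i-1}{i}\binom{s+j-1}{j}$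 for all $r,s\gg0$. *)

(* Defs.v *)
From HB Require Import structures.
From mathcomp Require Import all_boot all_order all_algebra.
From mathcomp Require Import generic_quotient ring_quotient.
From mathcomp Require Import boolp classical_sets functions cardinality.
From mathcomp Require Import fsbigop.
From mathcomp Require Import ring.

Set Implicit Arguments.
Unset Strict Implicit.
Unset Printing Implicit Defensive.

Import Order.TTheory GRing.Theory Num.Theory.
Local Open Scope quotient_scope.
Local Open Scope classical_set_scope.
Local Open Scope ring_scope.

Section Ideals.
Variable R : comNzRingType.
Implicit Types (A B I J K P Q M m : set R) (a b x y : R).

(* The unit ideal is allowed, unlike in [idealr_closed]. *)
Definition is_ideal I :=
  [/\ I 0, forall x y, I x -> I y -> I (x + y) & forall a x, I x -> I (a * x)].

Definition ideal_gen A : set R := smallest is_ideal A.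

Definition ideal_mul I J : set R :=
  ideal_gen [set x * y | x in I & y in J].

Definition ideal_add I J : set R := [set x + y | x in I & y in J].

Definition ideal_scale a I : set R := [set a * x | x in I].

Definition ideal_pow I (n : nat) : set R := iter n (ideal_mul I) [set: R].

Definition ideal_powz I (r : int) : set R :=
  if r is Posz n then ideal_pow I n else [set: R].

Definition is_prime P :=
  [/\ is_ideal P, ~ P 1 & forall x y, P (x * y) -> P x \/ P y].

Definition is_maximal M :=
  [/\ is_ideal M, ~ M 1
    & forall K, is_ideal K -> M `<=` K -> ~ K 1 -> K = M].

Definition radical I : set R := [set x | exists n, I (x ^+ n)].

Definition is_primary I :=
  [/\ is_ideal I, ~ I 1
    & forall x y, I (x * y) -> I x \/ exists n, I (y ^+ n)].

Definition is_m_primary m I := is_primary I /\ radical I = m.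

Definition is_local m := is_maximal m /\ forall M, is_maximal M -> M = m.

(* The elements of the residue field R / m are the cosets of m. *)
Definition infinite_residue_field m :=
  infinite_set (range (fun x => [set y | m (y - x)])).

Definition prime_chain n (p : nat -> set R) :=
  (forall i, (i <= n)%N -> is_prime (p i)) /\
  (forall i, (i < n)%N -> p i `<` p i.+1).

Definition is_regular_seq (s : seq R) :=
  (forall i, (i < size s)%N -> forall y,
     ideal_gen [set` take i s] (s`_i * y) -> ideal_gen [set` take i s] y) /\
  ~ ideal_gen [set` s] 1.

Definition has_depth m d :=
  (exists s, [/\ is_regular_seq s, [set` s] `<=` m & size s = d]) /\
  (forall s, is_regular_seq s -> [set` s] `<=` m -> (size s <= d)%N).

(* Submodules of R / K are the K' / K with K' an ideal containing K. *)
Definition quot_chain K n (p : nat -> set R) :=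
  [/\ forall i, (i <= n)%N -> is_ideal (p i) /\ K `<=` p i
    & forall i, (i < n)%N -> p i `<` p i.+1].

Definition has_colength K n :=
  (exists p, quot_chain K n p) /\
  (forall n' p, quot_chain K n' p -> (n' <= n)%N).

Definition is_hilbert_coefs K (e : nat -> int) :=
  exists N, forall n, (N <= n)%N ->
    exists2 l : nat, has_colength (ideal_pow K n) l
      & l%:Z = e 0%N * 'C(n.+1, 2)%:Z - e 1%N * n%:Z + e 2%N.

(* Only e 0, e 1 and e 2 are constrained. *)
Definition hilbert_coef K : nat -> int :=
  xget (fun=> 0) [set e | is_hilbert_coefs K e].

Definition is_bihilbert_coefs I J (e : nat -> nat -> int) :=
  exists N, forall r s, (N <= r)%N -> (N <= s)%N ->
    exists2 l : nat, has_colength (ideal_mul (ideal_pow I r) (ideal_pow J s)) l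
      & l%:Z = \sum_(i < 3) \sum_(j < 3 | (i + j <= 2)%N)
                 (-1) ^+ (i + j) * e i j
                   * 'C((r + i).-1, i)%:Z * 'C((s + j).-1, j)%:Z.

(* Only the e i j with i + j <= 2 are constrained. *)
Definition bihilbert_coef I J : nat -> nat -> int :=
  xget (fun _ _ => 0) [set e | is_bihilbert_coefs I J e].

Definition is_joint_reduction I J a b :=
  [/\ I a, J b
    & exists N, forall r s, (N <= r)%N -> (N <= s)%N ->
        ideal_mul (ideal_pow I r.+1) (ideal_pow J s.+1) =
        ideal_add (ideal_scale a (ideal_mul (ideal_pow I r) (ideal_pow J s.+1)))
                  (ideal_scale b (ideal_mul (ideal_pow I r.+1) (ideal_pow J s)))].

Definition joint_reduction_number0 I J :=
  exists a b, is_joint_reduction I J a b /\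
    ideal_mul I J = ideal_add (ideal_scale a J) (ideal_scale b I).

End Ideals.

Definition is_noetherian (R : comNzRingType) :=
  forall I : set R, is_ideal I -> exists s : seq R, I = ideal_gen [set` s].

Definition has_krull_dim (R : comNzRingType) (d : nat) :=
  (exists p : nat -> set R, prime_chain d p) /\
  (forall n (p : nat -> set R), prime_chain n p -> (n <= d)%N).

(* Meant for R local Noetherian with maximal ideal m: dim R = depth R. *)
Definition is_cohen_macaulay (R : comNzRingType) (m : set R) :=
  exists2 d, has_krull_dim R d & has_depth m d.

Section GroupAlgebra.
Variables (R : comNzRingType) (G : zmodType).

Definition finsupp_pred : {pred G -> R} :=
  [pred f | `[< finite_set [set n | f n != 0] >] ].

Lemma finsupp_zmod_closed : zmod_closed finsupp_pred.
Proof.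
split=> [|f g].
  by apply/asboolP; apply: (sub_finite_set _ (@finite_set0 G)) => n /=; rewrite eqxx.
move=> /asboolP Ff /asboolP Fg; apply/asboolP.
have : finite_set ([set n | f n != 0] `|` [set n | g n != 0]).
  by rewrite finite_setU.
apply: sub_finite_set => n /= fgn.
have [f0|?] := eqVneq (f n) 0; [right|by left].
by apply: contraNneq fgn => g0; rewrite /GRing.add /GRing.opp/= f0 g0 subrr.
Qed.

HB.instance Definition _ :=
  GRing.isZmodClosed.Build (G -> R) finsupp_pred finsupp_zmod_closed.

(* The group algebra of G over R: finitely supported functions under convolution.
   [galg R (int * int)] is R[t1^{+-1}, t2^{+-1}]. *)
Record galg := Galg { galg_fun :> G -> R; _ : galg_fun \in finsupp_pred }.

HB.instance Definition _ := [isSub for galg_fun].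
HB.instance Definition _ := [Choice of galg by <:].
HB.instance Definition _ := [SubChoice_isSubZmodule of galg by <:].

Implicit Types f g h : galg.

Definition covers (s : seq G) (f : G -> R) :=
  uniq s /\ forall n, f n != 0 -> n \in s.

Lemma galg_covers f : exists s, covers s f.
Proof.
have /asboolP/finite_seqP[s sE] := valP f.
exists (undup s); split; first exact: undup_uniq.
move=> n; rewrite mem_undup => fn.
by have : [set` s] n by rewrite -sE.
Qed.

Lemma galgD f g n : (f + g) n = f n + g n. Proof. by []. Qed.

Lemma galgN f n : (- f) n = - f n. Proof. by []. Qed.

Lemma galg_eqP f g : (forall n, f n = g n) -> f = g.
Proof. by move=> fg; apply: val_inj; apply/funext. Qed.

Definition convol (f g : G -> R) : G -> R :=
  fun n => \sum_(i \in [set: G]) f i * g (n - i).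

Lemma convolE (f g : G -> R) s t n : covers s f -> covers t g ->
  convol f g n = \sum_(i <- s) \sum_(j <- t) (f i * g j) *+ (i + j == n).
Proof.
move=> [us sf] [ut tg]; rewrite /convol.
rewrite (fsbigE s) //; last first.
  move=> i _ iNs; have -> : f i = 0 by apply/eqP; apply: contraNT iNs; exact: sf.
  by rewrite mul0r.
apply: eq_big => [i|i _]; first exact: in_setT.
case: (boolP (n - i \in t)) => nit.
  rewrite (bigD1_seq (n - i)) //= [i + _]addrC subrK eqxx mulr1n.
  rewrite big1 ?addr0 // => j jn; case: eqP => // ijn; case/eqP: jn.
  by rewrite -ijn addrAC subrr add0r.
rewrite big1_seq => [|j /= jt]; last first.
  by case: eqP => // ijn; move: nit; rewrite -ijn addrAC subrr add0r jt.
suff -> : g (n - i) = 0 by rewrite mulr0.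
by apply/eqP; apply: contraNT nit; exact: tg.
Qed.

Lemma convol_covers (f g : G -> R) s t : covers s f -> covers t g ->
  covers (undup [seq i + j | i <- s, j <- t]) (convol f g).
Proof.
move=> cf cg; split; first exact: undup_uniq.
move=> n; rewrite mem_undup (convolE _ cf cg); apply: contraNT => nst.
apply/eqP; rewrite big1_seq // => i /= si; rewrite big1_seq // => j /= tj.
case: eqP => // ijn; case/negP: nst.
by rewrite -ijn; apply/allpairsP; exists (i, j).
Qed.

Lemma covers_finsupp s (f : G -> R) : covers s f -> f \in finsupp_pred.
Proof.
move=> [_ sf]; apply/asboolP.
apply: (@sub_finite_set _ _ [set` s]); last exact: finite_seq.
by move=> n /= /sf.
Qed.

Lemma galg_mul_subproof f g : convol f g \in finsupp_pred.
Proof.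
have [s cf] := galg_covers f; have [t cg] := galg_covers g.
exact: covers_finsupp (convol_covers cf cg).
Qed.

Definition galg_mul f g := Galg (galg_mul_subproof f g).

Lemma galg_mulE f g n : galg_mul f g n = convol f g n. Proof. by []. Qed.

Definition galg_mono_fun (c : R) (d : G) : G -> R := fun n => c *+ (n == d).

Lemma galg_mono_covers c d : covers [:: d] (galg_mono_fun c d).
Proof.
split=> // n; rewrite /galg_mono_fun inE.
by case: (n == d); rewrite // mulr0n eqxx.
Qed.

(* The monomial c t^d, writing G multiplicatively. *)
Definition galg_mono c d := Galg (covers_finsupp (galg_mono_covers c d)).

Lemma galg_mulC : commutative galg_mul.
Proof.
move=> f g; apply: galg_eqP => n /=.
have [s cf] := galg_covers f; have [t cg] := galg_covers g.
rewrite (convolE _ cf cg) (convolE _ cg cf) exchange_big /=.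
by apply: eq_bigr => j _; apply: eq_bigr => i _; rewrite mulrC addrC.
Qed.

Lemma galg_mulDl : left_distributive galg_mul +%R.
Proof.
move=> f g h; apply: galg_eqP => n; rewrite galgD /=.
have [s [us sf]] := galg_covers f; have [t [ut tg]] := galg_covers g.
have [u ch] := galg_covers h.
pose w := undup (s ++ t).
have cf : covers w f.
  by split=> [|k /sf]; rewrite ?undup_uniq // mem_undup mem_cat => ->.
have cg : covers w g.
  by split=> [|k /tg]; rewrite ?undup_uniq // mem_undup mem_cat orbC => ->.
have cfg : covers w (f + g).
  split=> [|k]; first exact: undup_uniq.
  rewrite galgD; have [-> |/(proj2 cf) //] := eqVneq (f k) 0.
  by rewrite add0r => /(proj2 cg).
rewrite (convolE _ cfg ch) (convolE _ cf ch) (convolE _ cg ch).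
rewrite -big_split; apply: eq_bigr => i _ /=.
rewrite -big_split; apply: eq_bigr => j _ /=.
by rewrite -mulrnDl -mulrDl.
Qed.

Lemma galg_mul1 : left_id (galg_mono 1 0) galg_mul.
Proof.
move=> f; apply: galg_eqP => n /=.
have [s cf] := galg_covers f.
rewrite (convolE _ (galg_mono_covers _ _) cf) big_seq1.
under eq_bigr do rewrite /galg_mono_fun eqxx mulr1n mul1r add0r.
case: (boolP (n \in s)) => ns.
  rewrite (bigD1_seq n) ?(proj1 cf) //= eqxx mulr1n big1 ?addr0 // => j.
  by move=> /negPf->.
rewrite big1_seq => [|j /= js]; last by case: eqP => // jn; rewrite -jn js in ns.
by apply/esym/eqP; apply: contraNT ns; exact: (proj2 cf).
Qed.

Lemma galg_mul3E f g h s t u n :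
  covers s f -> covers t g -> covers u h ->
  galg_mul (galg_mul f g) h n =
  \sum_(i <- s) \sum_(j <- t) \sum_(k <- u)
    (f i * g j * h k) *+ (i + j + k == n).
Proof.
move=> cf cg ch /=.
rewrite (@convolE (galg_mul f g) h _ _ n (convol_covers cf cg) ch).
set w := undup _.
transitivity (\sum_(l <- w) \sum_(k <- u) \sum_(i <- s) \sum_(j <- t)
    ((f i * g j) *+ (i + j == l) * h k) *+ (l + k == n)).
  apply: eq_bigr => l _; apply: eq_bigr => k _.
  rewrite galg_mulE (convolE _ cf cg) mulr_suml -sumrMnl.
  by apply: eq_bigr => i _; rewrite mulr_suml -sumrMnl.
transitivity (\sum_(i <- s) \sum_(j <- t) \sum_(k <- u) \sum_(l <- w)
    ((f i * g j) *+ (i + j == l) * h k) *+ (l + k == n)).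
  rewrite exchange_big /=.
  under eq_bigr => k _ do rewrite exchange_big /=.
  rewrite exchange_big /=; apply: eq_bigr => i _.
  under eq_bigr => k _ do rewrite exchange_big /=.
  by rewrite exchange_big.
rewrite big_seq [RHS]big_seq; apply: eq_bigr => i si.
rewrite big_seq [RHS]big_seq; apply: eq_bigr => j tj.
apply: eq_bigr => k _.
have ijw : i + j \in w by rewrite mem_undup; apply/allpairsP; exists (i, j).
rewrite (bigD1_seq (i + j)) ?undup_uniq //= eqxx mulr1n big1 ?addr0 // => l lij.
by rewrite eq_sym (negPf lij) mulr0n mul0r mul0rn.
Qed.

Lemma galg_mulA : associative galg_mul.
Proof.
move=> f g h; rewrite [galg_mul f _]galg_mulC [galg_mul g h]galg_mulC.
apply: galg_eqP => n.
have [s cf] := galg_covers f; have [t cg] := galg_covers g.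
have [u ch] := galg_covers h.
rewrite (galg_mul3E _ ch cg cf) (galg_mul3E _ cf cg ch).
rewrite exchange_big.
under eq_bigr do rewrite exchange_big.
rewrite exchange_big; apply: eq_bigr => i _; apply: eq_bigr => j _.
apply: eq_bigr => k _; congr (_ *+ (_ == n)).
  by rewrite mulrC [h k * _]mulrC mulrA.
by rewrite addrC [k + j]addrC addrA.
Qed.

Lemma galg_1neq0 : galg_mono 1 0 != 0.
Proof.
apply/eqP => /(congr1 (fun f : galg => f 0)) /=.
by rewrite /galg_mono_fun eqxx mulr1n => /eqP; rewrite oner_eq0.
Qed.

HB.instance Definition _ := GRing.Zmodule_isComNzRing.Build galg
  galg_mulA galg_mulC galg_mul1 galg_mulDl galg_1neq0.

End GroupAlgebra.

Section IdealFacts.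
Variable R : comNzRingType.
Implicit Types (A I J K : set R).

Lemma ideal_genP A : is_ideal (ideal_gen A).
Proof.
split=> [K [[]]//|x y gx gy K KA|a x gx K KA].
  by have [[_ KD _] _] := KA; apply: KD; [exact: gx|exact: gy].
by have [[_ _ KM] _] := KA; apply: KM; exact: gx.
Qed.

Lemma ideal_gen_sub A K : is_ideal K -> A `<=` K -> ideal_gen A `<=` K.
Proof. by move=> iK AK x; apply. Qed.

Lemma sub_ideal_gen A : A `<=` ideal_gen A.
Proof. by move=> x Ax K [_]; apply. Qed.

Lemma ideal_setT : is_ideal [set: R]. Proof. by []. Qed.

Lemma ideal_mulP I J : is_ideal (ideal_mul I J).
Proof. exact: ideal_genP. Qed.

Lemma mem_ideal_mul I J x y : I x -> J y -> ideal_mul I J (x * y).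
Proof. by move=> Ix Jy; apply: sub_ideal_gen; exists x => //; exists y. Qed.

Lemma ideal_mul_sub I J K : is_ideal K ->
  (forall x y, I x -> J y -> K (x * y)) -> ideal_mul I J `<=` K.
Proof. by move=> iK IJK; apply: ideal_gen_sub => // _ [x Ix [y Jy <-]]; apply: IJK. Qed.

Lemma ideal_powP I n : is_ideal (ideal_pow I n).
Proof. by case: n => [|n]; [exact: ideal_setT|exact: ideal_mulP]. Qed.

Lemma ideal_powzP I r : is_ideal (ideal_powz I r).
Proof. by case: r => n; [exact: ideal_powP|exact: ideal_setT]. Qed.

Lemma ideal_colon I x : is_ideal I -> is_ideal [set y | I (x * y)].
Proof.
move=> [I0 ID IM]; split=> /= [|y z Iy Iz|a y Iy].
- by rewrite mulr0.
- by rewrite mulrDr; apply: ID.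
- by rewrite mulrCA; apply: IM.
Qed.

Lemma ideal_pow_add I m n x y :
  ideal_pow I m x -> ideal_pow I n y -> ideal_pow I (m + n) (x * y).
Proof.
move=> Imx; move: y; elim: m x Imx => [|m IHm] x Imx y Iny.
  by have [_ _ IM] := ideal_powP I n; exact: IM.
rewrite mulrC addSn.
suff : [set x | ideal_pow I (m + n).+1 (y * x)] x by [].
move: Imx; apply: (ideal_mul_sub (ideal_colon _ (ideal_powP _ _))) => a b Ia Ib /=.
by rewrite mulrCA [y * b]mulrC; apply: mem_ideal_mul => //; exact: IHm.
Qed.

Lemma ideal_pow_le I m n : (m <= n)%N -> ideal_pow I n `<=` ideal_pow I m.
Proof.
move=> /subnK <- x; elim: (n - m)%N => [//|k IHk]; rewrite addSn => Ix.
apply: IHk; move: Ix; apply: ideal_mul_sub; first exact: ideal_powP.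
by move=> a b _ Ib; have [_ _ IM] := ideal_powP I (k + m); exact: IM.
Qed.

Lemma ideal_powz_add I (r s : int) x y :
  ideal_powz I r x -> ideal_powz I s y -> ideal_powz I (r + s) (x * y).
Proof.
have aux (m : nat) (t : int) z w : (t <= m%:Z)%R -> ideal_pow I m z ->
    ideal_powz I t (z * w).
  case: t => [t|//] /= tm Iz; rewrite mulrC; have [_ _ IM] := ideal_powP I t.
  by apply: IM; apply: ideal_pow_le Iz.
case: r s => [m|m] [n|n] Ix Iy.
- exact: ideal_pow_add.
- by apply: (aux m) => //; rewrite gerDl.
- by rewrite mulrC; apply: (aux n) => //; rewrite gerDr.
- by [].
Qed.

End IdealFacts.

Section ExtendedRees.
Variables (R : comNzRingType) (I J : set R).

Local Notation laurent := (galg R (int * int)%type).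

(* The sum of the I^r J^s t1^r t2^s, with (r, s) in Z x Z. *)
Definition rees_pred : {pred laurent} :=
  [pred f : laurent | `[< forall r s : int,
     ideal_mul (ideal_powz I r) (ideal_powz J s) (f (r, s)) >] ].

Lemma rees_mono_mem c r s :
  ideal_mul (ideal_powz I r) (ideal_powz J s) c ->
  galg_mono c (r, s) \in rees_pred.
Proof.
move=> IJc; apply/asboolP => r' s' /=; rewrite /galg_mono_fun.
case: eqP => [[-> ->]|_]; first by rewrite mulr1n.
by have [] := ideal_mulP (ideal_powz I r') (ideal_powz J s').
Qed.

Lemma rees_subring_closed : subring_closed rees_pred.
Proof.
split.
- apply: rees_mono_mem; rewrite -[1]mulr1; exact: mem_ideal_mul.
- move=> f g /asboolP Ff /asboolP Fg; apply/asboolP => r s.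
  have [_ KD KM] := ideal_mulP (ideal_powz I r) (ideal_powz J s).
  rewrite galgD; apply: KD; first exact: Ff.
  by rewrite galgN -mulN1r; apply: KM; exact: Fg.
- move=> f g /asboolP Ff /asboolP Fg; apply/asboolP => r s.
  set K := ideal_mul _ _; have [K0 KD KM] : is_ideal K by exact: ideal_mulP.
  have [u cf] := galg_covers f; have [v cg] := galg_covers g.
  rewrite galg_mulE (convolE _ cf cg).
  elim/big_ind: _ => // -[i1 i2] _; elim/big_ind: _ => // -[j1 j2] _.
  case: eqP => [[e1 e2]|_]; last by rewrite mulr0n.
  have KE : K = ideal_mul (ideal_powz I (i1 + j1)) (ideal_powz J (i2 + j2)).
    by rewrite /K -e1 -e2.
  rewrite mulr1n; move: (Ff i1 i2) (Fg j1 j2).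
  move: (f _) (g _) => x y IJx IJy.
  suff : [set x | K (y * x)] x by rewrite /= mulrC.
  move: IJx; apply: ideal_mul_sub; first exact/ideal_colon/ideal_mulP.
  move=> a b Ia Jb /=; rewrite mulrC.
  suff : [set y | K (a * b * y)] y by [].
  move: IJy; apply: ideal_mul_sub; first exact/ideal_colon/ideal_mulP.
  move=> c d Ic Jd /=; rewrite mulrACA KE; apply: mem_ideal_mul;
    exact: ideal_powz_add.
Qed.

HB.instance Definition _ :=
  GRing.isSubringClosed.Build laurent rees_pred rees_subring_closed.

Record ext_rees := ExtRees { rees_val :> laurent; _ : rees_val \in rees_pred }.

HB.instance Definition _ := [isSub for rees_val].
HB.instance Definition _ := [Choice of ext_rees by <:].
HB.instance Definition _ := [SubChoice_isSubComNzRing of ext_rees by <:].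

(* The monomial c t1^r t2^s, for c in I^r J^s (junk value 0 otherwise). *)
Definition rees_mono (c : R) (r s : int) : ext_rees :=
  insubd 0 (galg_mono c (r, s)).

Definition rees_homog (d : int * int) : set ext_rees :=
  [set f | forall e, e != d -> f e = 0].

End ExtendedRees.

Section Localization.
Variables (S : comNzRingType) (x : S).

(* The pair (f, n) stands for the fraction f / x^n. *)
Definition loc_equiv (p q : S * nat) : bool :=
  `[< exists k, x ^+ k * (x ^+ q.2 * p.1 - x ^+ p.2 * q.1) = 0 >].

Lemma loc_equiv_is_equiv : equiv_class_of loc_equiv.
Proof.
split=> [[f n]|[f n] [g m]|[g m] [f n] [h l]].
- by apply/asboolP; exists 0%N; rewrite subrr mulr0.
- by apply/idP/idP => /asboolP/= [k kE]; apply/asboolP; exists k;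
    rewrite /= -opprB mulrN kE oppr0.
- move=> /asboolP[k /= kE] /asboolP[k' /= k'E]; apply/asboolP => /=.
  exists (k + k' + m)%N; rewrite !exprD.
  have -> : x ^+ k * x ^+ k' * x ^+ m * (x ^+ l * f - x ^+ n * h) =
      x ^+ k' * x ^+ l * (x ^+ k * (x ^+ m * f - x ^+ n * g)) +
      x ^+ k * x ^+ n * (x ^+ k' * (x ^+ l * g - x ^+ m * h)) by ring.
  by rewrite kE k'E !mulr0 addr0.
Qed.

Canonical loc_equiv_equiv := EquivRelPack loc_equiv_is_equiv.
Canonical loc_encModRel := defaultEncModRel loc_equiv.

Definition loc := {eq_quot loc_equiv}.

HB.instance Definition _ : EqQuotient (S * nat)%type loc_equiv loc :=
  EqQuotient.on loc.
HB.instance Definition _ := Choice.on loc.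

Definition loc_frac (f : S) (n : nat) : loc := \pi_loc (f, n).

Lemma loc_fracP f n g m :
  loc_frac f n = loc_frac g m <->
  exists k, x ^+ k * (x ^+ m * f - x ^+ n * g) = 0.
Proof.
by split=> [/eqmodP/asboolP|fg]; last exact/eqmodP/asboolP.
Qed.

Lemma loc_ind (P : loc -> Prop) : (forall f n, P (loc_frac f n)) -> forall u, P u.
Proof. by move=> Pf; elim/quotW => -[f n]; exact: Pf. Qed.

Lemma loc_reprP (u : loc) : u = loc_frac (repr u).1 (repr u).2.
Proof. by rewrite /loc_frac -surjective_pairing reprK. Qed.

Definition loc_zero : loc := loc_frac 0 0.

Definition loc_opp (u : loc) : loc := loc_frac (- (repr u).1) (repr u).2.

Definition loc_add (u v : loc) : loc :=
  loc_frac (x ^+ (repr v).2 * (repr u).1 + x ^+ (repr u).2 * (repr v).1)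
           ((repr u).2 + (repr v).2).

Lemma loc_oppE f n : loc_opp (loc_frac f n) = loc_frac (- f) n.
Proof.
rewrite /loc_opp; have := loc_reprP (loc_frac f n).
case: (repr _) => g m /= /loc_fracP[k kE]; apply/loc_fracP; exists k.
by rewrite -[RHS]kE; ring.
Qed.

Lemma loc_addE f n g m : loc_add (loc_frac f n) (loc_frac g m) =
  loc_frac (x ^+ m * f + x ^+ n * g) (n + m).
Proof.
rewrite /loc_add; have := loc_reprP (loc_frac f n); have := loc_reprP (loc_frac g m).
case: (repr _) => g' m' /= /loc_fracP[k kE]; case: (repr _) => f' n' /= /loc_fracP[l lE].
apply/loc_fracP; exists (k + l)%N; rewrite !exprD.
have -> : x ^+ k * x ^+ l * (x ^+ n * x ^+ m * (x ^+ m' * f' + x ^+ n' * g') -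
    x ^+ n' * x ^+ m' * (x ^+ m * f + x ^+ n * g)) =
  - (x ^+ k * x ^+ m * x ^+ m' * (x ^+ l * (x ^+ n' * f - x ^+ n * f'))
  + x ^+ l * x ^+ n * x ^+ n' * (x ^+ k * (x ^+ m' * g - x ^+ m * g'))) by ring.
by rewrite kE lE !mulr0 addr0 oppr0.
Qed.

Lemma loc_addA : associative loc_add.
Proof.
elim/loc_ind => f n; elim/loc_ind => g m; elim/loc_ind => h l.
rewrite !loc_addE addnA; congr loc_frac; rewrite !exprD; ring.
Qed.

Lemma loc_addC : commutative loc_add.
Proof.
elim/loc_ind => f n; elim/loc_ind => g m.
by rewrite !loc_addE addnC addrC.
Qed.

Lemma loc_add0 : left_id loc_zero loc_add.
Proof.
by elim/loc_ind => f n; rewrite loc_addE mulr0 add0r expr0 mul1r.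
Qed.

Lemma loc_addN : left_inverse loc_zero loc_opp loc_add.
Proof.
elim/loc_ind => f n; rewrite loc_oppE loc_addE mulrN addNr.
by apply/loc_fracP; exists 0%N; rewrite !mulr0 subrr mulr0.
Qed.

HB.instance Definition _ :=
  GRing.isZmodule.Build loc loc_addA loc_addC loc_add0 loc_addN.

End Localization.

Section LocMap.
Variables (S : comNzRingType) (x w z : S) (zE : z = x * w).

(* The canonical map S_x -> S_z for z = x w. *)
Definition loc_map (u : loc x) : loc z :=
  loc_frac z ((repr u).1 * w ^+ (repr u).2) (repr u).2.

Lemma loc_mapE f n : loc_map (loc_frac x f n) = loc_frac z (f * w ^+ n) n.
Proof.
rewrite /loc_map; have := loc_reprP (loc_frac x f n).
case: (repr _) => g m /= /loc_fracP[k kE]; apply/loc_fracP; exists k.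
rewrite zE !exprMn.
have -> : x ^+ k * w ^+ k * (x ^+ n * w ^+ n * (g * w ^+ m) -
    x ^+ m * w ^+ m * (f * w ^+ n)) =
  - (w ^+ k * w ^+ n * w ^+ m * (x ^+ k * (x ^+ m * f - x ^+ n * g))) by ring.
by rewrite kE mulr0 oppr0.
Qed.

Lemma loc_map_is_zmod_morphism : zmod_morphism loc_map.
Proof.
elim/loc_ind => f n; elim/loc_ind => g m.
rewrite [X in loc_map X](_ : _ = loc_frac x (x ^+ m * f - x ^+ n * g) (n + m)).
  rewrite !loc_mapE.
  rewrite [RHS](_ : _ = loc_frac z (z ^+ m * (f * w ^+ n) - z ^+ n * (g * w ^+ m)) (n + m)).
    congr loc_frac; rewrite zE !exprMn !exprD; ring.
  transitivity (loc_add (loc_frac z (f * w ^+ n) n) (loc_opp (loc_frac z (g * w ^+ m) m))) => //.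
  by rewrite loc_oppE loc_addE mulrN.
transitivity (loc_add (loc_frac x f n) (loc_opp (loc_frac x g m))) => //.
by rewrite loc_oppE loc_addE mulrN.
Qed.

End LocMap.

Section LocalCohomology.
Variables (S : comNzRingType) (x y : S).

(* The last differential of the Cech complex
   0 -> S -> S_x (+) S_y -> S_(xy) -> 0, whose cohomology is that of S with
   support in (x, y). *)
Definition cech_d1 (p : loc x * loc y) : loc (x * y) :=
  loc_map y (x * y) p.1 - loc_map x (x * y) p.2.

Definition cech_B2 : {pred loc (x * y)} :=
  [pred u | `[< range cech_d1 u >] ].

Lemma cech_B2_zmod_closed : zmod_closed cech_B2.
Proof.
have mx := loc_map_is_zmod_morphism (erefl (x * y)).
have my := loc_map_is_zmod_morphism (mulrC x y).
split.
  apply/asboolP; exists (0, 0) => //; rewrite /cech_d1 /=.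
  by rewrite -[in X in X - _](subrr 0) mx -[in X in _ - X](subrr 0) my !subrr.
move=> _ _ /asboolP[[u v] _ <-] /asboolP[[u' v'] _ <-].
apply/asboolP; exists (u - u', v - v') => //; rewrite /cech_d1 /= mx my.
by rewrite !opprD [RHS]addrACA.
Qed.

HB.instance Definition _ :=
  GRing.isZmodClosed.Build (loc (x * y)) cech_B2 cech_B2_zmod_closed.

Definition local_cohomology2 := Quotient.quot cech_B2.

(* For S graded by the S_d, with x y homogeneous of degree dxy. *)
Definition local_cohomology2_component (G : zmodType) (S_ : G -> set S)
    (dxy d : G) : set local_cohomology2 :=
  [set u | exists n : nat, exists2 f : S, S_ (d + dxy *+ n) f
    & u = \pi_local_cohomology2 (loc_frac (x * y) f n)].

End LocalCohomology.

(* [H^2_{(a t1, b t2)}(R')]_(r, s), where R' is the extended Rees algebra. *)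
Definition rees_H2 (R : comNzRingType) (I J : set R) (a b : R) (r s : int) :
    set (local_cohomology2 (rees_mono I J a 1 0) (rees_mono I J b 0 1)) :=
  local_cohomology2_component (@rees_homog R I J) (1, 1) (r, s).

Arguments rees_H2 {R} I J a b r s.

(* Main.v *)
(* All the numbers involved are read off from lengths. Let (a, b) be a joint reduction,
   e = l(R/(a,b)) and D(r,s) = r s e + l(R/I^r) + l(R/J^s) - l(R/I^r J^s). As (a^r, b^s) is
   a regular sequence, D(r,s) is the length of I^r J^s / (a^r J^s + b^s I^r). Hence D >= 0,
   and D is eventually linear in r and s with coefficients e_(1,0) - e_1(I) and
   e_(0,1) - e_1(J) and constant term e_2(I) + e_2(J) - e_2(IJ). So (b) says that D(k,k)
   vanishes for large k, that is I^k J^k = a^k J^k + b^k I^k, which is (a).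
   The component of the local cohomology in (c) is the direct limit of the modules
   I^k J^k / (a^k J^k + b^k I^k) under multiplication by ab, and these maps are injective
   for large k if a and b are superficial for I and J.

   The existence of joint reductions is an Eakin-Sathaye argument, based on the linear
   growth of the number of generators of I^n J^n. Hilbert polynomials exist because the
   mixed second difference of l(R/I^r J^s) is eventually at least e, while its sums over
   rectangles exceed those of e by a bounded amount only. Superficial elements exist
   because the modules (I^(n+1) : a_t) / I^n of members a_t of a generic family are
   independent, and their total length is at most e_2(I). *)

Require Import Defs.
From mathcomp Require Import all_boot all_order all_algebra.
From mathcomp Require Import boolp classical_sets functions cardinality.
From mathcomp Require Import generic_quotient ring_quotient.
From mathcomp Require Import ring zify.

Set Implicit Arguments.
Unset Strict Implicit.
Unset Printing Implicit Defensive.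

Import GRing.Theory.
Local Open Scope classical_set_scope.
Local Open Scope quotient_scope.
Local Open Scope ring_scope.

Local Notation "A <+> B" := (ideal_add A B) (at level 50, left associativity).
Local Notation "A <**> B" := (ideal_mul A B) (at level 40, left associativity).
Local Notation "a *> A" := (ideal_scale a A) (at level 40).
Local Notation "A ^^ n" := (ideal_pow A n) (at level 30, right associativity).
Local Notation "A :% a" := [set y | A (a * y)] (at level 40, left associativity).

(** * Ideals *)

Section IdealAlgebra.
Variable R : comNzRingType.
Implicit Types (A B C I J K L M P Q X Y Z : set R) (a b c x y z : R).

Lemma idl0 I : is_ideal I -> I 0. Proof. by case. Qed.

Lemma idlD I x y : is_ideal I -> I x -> I y -> I (x + y).
Proof. by move=> [_ ID _]; exact: ID. Qed.

Lemma idlMl I a x : is_ideal I -> I x -> I (a * x).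
Proof. by move=> [_ _ IM]; exact: IM. Qed.

Lemma idlMr I a x : is_ideal I -> I x -> I (x * a).
Proof. by rewrite mulrC; exact: idlMl. Qed.

Lemma idlN I x : is_ideal I -> I x -> I (- x).
Proof. by rewrite -mulN1r; exact: idlMl. Qed.

Lemma idlB I x y : is_ideal I -> I x -> I y -> I (x - y).
Proof. by move=> iI Ix Iy; apply: idlD => //; exact: idlN. Qed.

Lemma ideal_eqT I : is_ideal I -> I 1 -> I = [set: R].
Proof. by move=> iI I1; apply/seteqP; split=> // x _; rewrite -[x]mulr1; exact: idlMl. Qed.

Lemma ideal_addP A B : is_ideal A -> is_ideal B -> is_ideal (A <+> B).
Proof.
move=> iA iB; split.
- by exists 0; [exact: idl0 | exists 0; rewrite ?addr0 //; exact: idl0].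
- move=> _ _ [x Ax [y By <-]] [x' Ax' [y' By' <-]].
  by exists (x + x'); [exact: idlD | exists (y + y'); [exact: idlD | ring]].
- move=> a _ [x Ax [y By <-]].
  by exists (a * x); [exact: idlMl | exists (a * y); [exact: idlMl | ring]].
Qed.

Lemma ideal_add_sub A B K : is_ideal K -> A `<=` K -> B `<=` K -> A <+> B `<=` K.
Proof. by move=> iK AK BK _ [x /AK Kx [y /BK Ky <-]]; exact: idlD. Qed.

Lemma sub_addl A B : is_ideal B -> A `<=` A <+> B.
Proof. by move=> iB x Ax; exists x => //; exists 0; rewrite ?addr0 //; exact: idl0. Qed.

Lemma sub_addr A B : is_ideal A -> B `<=` A <+> B.
Proof. by move=> iA x Bx; exists 0; [exact: idl0 | exists x; rewrite ?add0r]. Qed.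

Lemma ideal_addC A B : A <+> B = B <+> A.
Proof. by apply/seteqP; split=> _ [x Ax [y By <-]]; exists y => //; exists x => //;
  rewrite addrC. Qed.

Lemma ideal_addA A B C : A <+> (B <+> C) = A <+> B <+> C.
Proof.
apply/seteqP; split=> [_ [x Ax [_ [y By [z Cz <-]] <-]]|_ [_ [x Ax [y By <-]] [z Cz <-]]].
  by exists (x + y); [exists x => //; exists y | exists z; rewrite ?addrA].
by exists x => //; exists (y + z); [exists y => //; exists z | rewrite ?addrA].
Qed.

Lemma ideal_addS A A' B B' : A `<=` A' -> B `<=` B' -> A <+> B `<=` A' <+> B'.
Proof. by move=> AA' BB' _ [x /AA' ? [y /BB' ? <-]]; exists x => //; exists y. Qed.

Lemma ideal_add_idr A B : is_ideal A -> is_ideal B -> B `<=` A -> A <+> B = A.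
Proof.
by move=> iA iB BA; apply/seteqP; split; [exact: ideal_add_sub | exact: sub_addl].
Qed.

Lemma ideal_scaleP a A : is_ideal A -> is_ideal (a *> A).
Proof.
move=> iA; split.
- by exists 0; rewrite ?mulr0 //; exact: idl0.
- by move=> _ _ [x Ax <-] [y Ay <-]; exists (x + y); [exact: idlD | ring].
- by move=> b _ [x Ax <-]; exists (b * x); [exact: idlMl | ring].
Qed.

Lemma ideal_scale_sub a A K : is_ideal K -> K a -> a *> A `<=` K.
Proof. by move=> iK Ka _ [x _ <-]; exact: idlMr. Qed.

Lemma ideal_scaleS a A B : A `<=` B -> a *> A `<=` a *> B.
Proof. by move=> AB _ [x /AB Bx <-]; exists x. Qed.

Lemma ideal_scaleT a : (a *> [set: R]) a. Proof. by exists 1; rewrite ?mulr1. Qed.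

Lemma ideal_setI A B : is_ideal A -> is_ideal B -> is_ideal (A `&` B).
Proof.
move=> iA iB; split; first by split; exact: idl0.
  by move=> x y [Ax Bx] [Ay By]; split; exact: idlD.
by move=> a x [Ax Bx]; split; exact: idlMl.
Qed.

Lemma sub_colon A a : is_ideal A -> A `<=` A :% a.
Proof. by move=> iA x Ax; exact: idlMl. Qed.

Lemma ideal_mulC A B : A <**> B = B <**> A.
Proof.
suff sub (C D : set R) : C <**> D `<=` D <**> C by apply/seteqP; split; exact: sub.
by apply: ideal_mul_sub => [|x y Cx Dy]; [exact: ideal_mulP | rewrite mulrC; exact: mem_ideal_mul].
Qed.

Lemma ideal_mulS A A' B B' : A `<=` A' -> B `<=` B' -> A <**> B `<=` A' <**> B'.
Proof.
move=> AA' BB'; apply: ideal_mul_sub; first exact: ideal_mulP.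
by move=> x y /AA' ? /BB' ?; exact: mem_ideal_mul.
Qed.

Lemma ideal_mulA A B C : A <**> (B <**> C) = A <**> B <**> C.
Proof.
have half (D E F : set R) : D <**> (E <**> F) `<=` D <**> E <**> F.
  apply: ideal_mul_sub => [|x y Dx]; first exact: ideal_mulP.
  move: y; apply: (ideal_mul_sub (ideal_colon x (ideal_mulP _ _))) => y z Ey Fz /=.
  by rewrite mulrA; apply: mem_ideal_mul => //; exact: mem_ideal_mul.
apply/seteqP; split; first exact: half.
by rewrite ideal_mulC [A <**> B]ideal_mulC [A <**> _]ideal_mulC [B <**> C]ideal_mulC; exact: half.
Qed.

Lemma ideal_mulCA A B C : A <**> (B <**> C) = B <**> (A <**> C).
Proof. by rewrite !ideal_mulA [A <**> B]ideal_mulC. Qed.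

Lemma ideal_mulACA A B C D : A <**> B <**> (C <**> D) = A <**> C <**> (B <**> D).
Proof. by rewrite -!ideal_mulA [B <**> _]ideal_mulCA. Qed.

Lemma ideal_mulT A : is_ideal A -> A <**> [set: R] = A.
Proof.
move=> iA; apply/seteqP; split; first by apply: ideal_mul_sub => // x y Ax _; exact: idlMr.
by move=> x Ax; rewrite -[x]mulr1; exact: mem_ideal_mul.
Qed.

Lemma ideal_Tmul A : is_ideal A -> [set: R] <**> A = A.
Proof. by rewrite ideal_mulC; exact: ideal_mulT. Qed.

Lemma ideal_mul_subl A B : is_ideal A -> A <**> B `<=` A.
Proof. by move=> iA; apply: ideal_mul_sub => // x y Ax _; exact: idlMr. Qed.

Lemma ideal_mul_subr A B : is_ideal B -> A <**> B `<=` B.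
Proof. by rewrite ideal_mulC; exact: ideal_mul_subl. Qed.

Lemma ideal_scale_mul a A B : A a -> a *> B `<=` A <**> B.
Proof. by move=> Aa _ [x Bx <-]; exact: mem_ideal_mul. Qed.

Lemma ideal_mul_scale a A B : A <**> (a *> B) = a *> (A <**> B).
Proof.
apply/seteqP; split.
  apply: ideal_mul_sub => [|x _ Ax [y By <-]]; first exact/ideal_scaleP/ideal_mulP.
  by exists (x * y); [exact: mem_ideal_mul | ring].
move=> _ [x ABx <-]; move: x ABx.
apply: (ideal_mul_sub (ideal_colon a (ideal_mulP _ _))) => x y Ax By /=.
by rewrite mulrCA; apply: mem_ideal_mul => //; exists y.
Qed.

Lemma ideal_mulDr A B C : is_ideal B -> is_ideal C ->
  A <**> (B <+> C) = A <**> B <+> A <**> C.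
Proof.
move=> iB iC; have iAB := ideal_mulP A B; have iAC := ideal_mulP A C.
apply/seteqP; split.
  apply: ideal_mul_sub => [|x _ Ax [y By [z Cz <-]]]; first exact: ideal_addP.
  by rewrite mulrDr; exists (x * y); [exact: mem_ideal_mul | exists (x * z) => //;
    exact: mem_ideal_mul].
by apply: ideal_add_sub; [exact: ideal_mulP | |]; apply: ideal_mulS => //;
  [exact: sub_addl | exact: sub_addr].
Qed.

Lemma ideal_pow1 A : is_ideal A -> A ^^ 1 = A.
Proof. exact: ideal_mulT. Qed.

Lemma ideal_powS A n : A ^^ n.+1 = A <**> A ^^ n. Proof. by []. Qed.

Lemma ideal_powD A n k : A ^^ (n + k) = A ^^ n <**> A ^^ k.
Proof.
elim: n => [|n IHn]; first by rewrite ideal_Tmul //; exact: ideal_powP.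
by rewrite addSn !ideal_powS IHn ideal_mulA.
Qed.

Lemma ideal_powM A n k : (A ^^ n) ^^ k = A ^^ (n * k).
Proof. by elim: k => [|k IHk]; rewrite ?muln0 // mulnS ideal_powD ideal_powS IHk. Qed.

Lemma ideal_mul_pow A B n : (A <**> B) ^^ n = A ^^ n <**> B ^^ n.
Proof.
elim: n => [|n IHn]; first by rewrite /= ideal_mulT.
by rewrite !ideal_powS IHn ideal_mulACA.
Qed.

Lemma mem_ideal_pow A a n : A a -> (A ^^ n) (a ^+ n).
Proof. by move=> Aa; elim: n => // n IHn; rewrite exprS; exact: mem_ideal_mul. Qed.

End IdealAlgebra.
Ltac ideal_tac := solve [repeat first
  [assumption | apply: ideal_mulP | apply: ideal_powP | apply: ideal_genP
  | apply: ideal_setT | apply: ideal_addP | apply: ideal_scaleP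
  | apply: ideal_setI | apply: ideal_colon]].
#[local] Hint Extern 0 (is_ideal _) => ideal_tac : core.


(** * Length *)

Section Length.
Variable R : comNzRingType.
Implicit Types (A B C I J K L M P Q X Y Z : set R) (a b c x y z : R).

(** Only the top is pinned to [L]; the bottom ideal merely contains [K]. Chains can thus be widened
    at either end without changing [n]. *)
Fixpoint chain K L n : Prop :=
  is_ideal L /\
  (if n is n'.+1 then exists M, chain K M n' /\ M `<` L else K `<=` L).

Lemma chain_ideal K L n : chain K L n -> is_ideal L. Proof. by case: n => [|n] []. Qed.

Lemma chain_sub K L n : chain K L n -> K `<=` L.
Proof.
elim: n L => [|n IHn] L [] // iL [M [/IHn KM [ML _]]].
exact: subset_trans ML.
Qed.

Lemma chain0 K : is_ideal K -> chain K K 0. Proof. by move=> iK; split. Qed.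

Lemma chain_widen K L L' n : is_ideal L' -> L `<=` L' -> chain K L n -> chain K L' n.
Proof.
move=> iL' LL'; case: n => [|n] [iL KL]; first by split=> //; exact: subset_trans LL'.
case: KL => M [cM [ML LM]]; split=> //; exists M; split=> //; split; first exact: subset_trans LL'.
by move=> L'M; apply: LM; exact: subset_trans L'M.
Qed.

Lemma chainS K M L n : is_ideal L -> chain K M n -> M `<` L -> chain K L n.+1.
Proof. by move=> iL cM ML; split=> //; exists M. Qed.

Lemma chain_cat K L M n k : chain K L n -> chain L M k -> chain K M (n + k).
Proof.
move=> cKL; elim: k M => [|k IHk] M [iM]; first by rewrite addn0 => LM; exact: chain_widen cKL.
by move=> [N [/IHk cN NM]]; rewrite addnS; exact: chainS NM.
Qed.

(** By the modular law, a strict step stays strict after intersecting with [L] or else after adding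
    [L]; [n1] counts the steps of the first kind and [n2] the others. Additivity of length follows
    without a Jordan-Hoelder theorem. *)
Lemma chain_split K L M n : is_ideal L -> K `<=` L -> chain K M n ->
  exists n1 n2, [/\ (n1 + n2 = n)%N, chain K (M `&` L) n1 & chain L (M <+> L) n2].
Proof.
move=> iL KL; elim: n M => [|n IHn] M [iM].
  move=> KM; exists 0%N, 0%N; split=> //; split=> //; first by move=> x Kx; split;
    [exact: KM | exact: KL].
  exact: sub_addr.
move=> [N [cN [NM MN]]]; have iN := chain_ideal cN.
have [n1 [n2 [n12 c1 c2]]] := IHn _ cN.
have c2M : chain L (M <+> L) n2 by apply: chain_widen c2 => //; exact: ideal_addS.
have NMi : N `&` L `<=` M `&` L by move=> x [/NM].
have c1M : chain K (M `&` L) n1 by apply: chain_widen c1.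
have [MNi|MNi] := pselect (M `&` L `<=` N `&` L); last first.
  by exists n1.+1, n2; split=> //; [rewrite addSn n12 | exact: chainS c1 _].
exists n1, n2.+1; split=> //; first by rewrite addnS n12.
apply: chainS c2 _ => //; split; first exact: ideal_addS.
move=> MNa; apply: MN => x Mx.
have [y Ny [z Lz yzx]] : (N <+> L) x by apply: MNa; exact: sub_addl.
rewrite -yzx; apply: idlD => //.
suff [] : (N `&` L) z by [].
by apply: MNi; split=> //; rewrite -[z](addKr y) yzx addrC; apply: idlB => //; exact: NM.
Qed.

(** A strictly monotone map between intervals of ideals transports chains; both isomorphism theorems
    below are pairs of such maps. *)
Lemma chain_map (f : set R -> set R) K L K' L' n :
  (forall M, is_ideal M -> K `<=` M -> M `<=` L ->
     [/\ is_ideal (f M), K' `<=` f M & f M `<=` L']) ->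
  (forall M N, is_ideal M -> is_ideal N -> K `<=` M -> M `<=` N -> N `<=` L ->
     f M `<=` f N /\ (f N `<=` f M -> N `<=` M)) ->
  is_ideal L' -> chain K L n -> chain K' L' n.
Proof.
move=> fP fS iL' cL.
suff H k M : chain K M k -> M `<=` L -> chain K' (f M) k.
  have [_ _ fL] := fP L (chain_ideal cL) (chain_sub cL) (@subset_refl _ L).
  by apply: chain_widen fL _ => //; exact: H.
elim: k M => [|k IHk] M cM ML; have iM := chain_ideal cM; have KM := chain_sub cM.
  by have [] := fP M iM KM ML.
have [iM' _ _] := fP M iM KM ML.
case: cM => _ [N [cN [NM MN]]]; have iN := chain_ideal cN; have KN := chain_sub cN.
have [fNM fMN] := fS _ _ iN iM KN NM ML.
by apply: chainS (IHk _ cN _) _ => //; [exact: subset_trans ML | split=> // /fMN].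
Qed.

Definition is_len K L n := chain K L n /\ forall k, chain K L k -> (k <= n)%N.

Lemma is_len_unique K L n k : is_len K L n -> is_len K L k -> n = k.
Proof. by move=> [cn mn] [ck mk]; apply/eqP; rewrite eqn_leq mk // mn. Qed.

Lemma is_len_exists K L (b : nat) : is_ideal K -> is_ideal L -> K `<=` L ->
  (forall k, chain K L k -> (k <= b)%N) -> exists n, is_len K L n.
Proof.
move=> iK iL KL bP.
have ex : exists n, `[< chain K L n >] by exists 0%N; apply/asboolP.
have ub i : `[< chain K L i >] -> (i <= b)%N by move/asboolP; exact: bP.
case: (ex_maxnP ex ub) => n /asboolP cn maxn; exists n; split=> // k ck.
by apply: maxn; apply/asboolP.
Qed.

Lemma is_len_add K L M n k : is_ideal L -> is_len K L n -> is_len L M k -> is_len K M (n + k).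
Proof.
move=> iL [cn mn] [ck mk]; split; first exact: chain_cat ck.
move=> l /(chain_split iL (chain_sub cn))[l1 [l2 [<- c1 c2]]].
apply: leq_add; first by apply: mn; apply: chain_widen c1 => // x [].
have iM := chain_ideal ck.
by apply: mk; apply: chain_widen c2 => //; apply: ideal_add_sub => //; exact: chain_sub ck.
Qed.

(** The isomorphism (P + Q) / P = Q / (P ∩ Q), on lattices of submodules. *)
Lemma chain_add_modular P Q n : is_ideal P -> is_ideal Q ->
  chain P (P <+> Q) n <-> chain (P `&` Q) Q n.
Proof.
move=> iP iQ; split.
  apply: (@chain_map (fun M => M `&` Q)) => //.
    by move=> M iM PM MPQ; split=> // x [] // /PM.
  move=> M N iM iN PM MN NPQ; split; first by move=> x [/MN].
  move=> NM x Nx; have [y Py [z Qz yzx]] := NPQ x Nx.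
  rewrite -yzx; apply: idlD => //; first exact: PM.
  suff [] : (M `&` Q) z by [].
  by apply: NM; split=> //; rewrite -[z](addKr y) yzx addrC; apply: idlB => //; exact/MN/PM.
apply: (@chain_map (fun M => P <+> M)) => //.
  move=> M iM PM MPQ; split=> //; [exact: sub_addl | exact: ideal_addS].
move=> M N iM iN PM MN NPQ; split; first exact: ideal_addS.
move=> NM x Nx; have [y Py [z Mz yzx]] : (P <+> M) x by apply: NM; exact: sub_addr.
rewrite -yzx; apply: idlD => //; apply: PM; split=> //.
by rewrite -[y](addrK z) yzx; apply: idlB => //; apply: NPQ => //; exact: MN.
Qed.

(** Multiplication by [a] identifies R / (Q : a) with (Q + aR) / Q. *)
Lemma chain_colon Q a n : is_ideal Q ->
  chain Q (Q <+> a *> [set: R]) n <-> chain (Q :% a) [set: R] n.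
Proof.
move=> iQ; have iaR : is_ideal (a *> [set: R]) by [].
split.
  apply: (@chain_map (fun M => M :% a)) => //.
    by move=> M iM QM MQ; split=> // x /=; exact: QM.
  move=> M N iM iN QM MN NQ; split; first by move=> x /=; exact: MN.
  move=> NM x Nx; have [q Qq [_ [r _ <-] qrx]] := NQ x Nx.
  rewrite -qrx; apply: idlD => //; first exact: QM.
  apply: (NM r); rewrite /= -[a * r](addKr q) qrx addrC; apply: idlB => //.
  exact/MN/QM.
apply: (@chain_map (fun M => Q <+> a *> M)) => //.
  by move=> M iM QM _; split=> //; [exact: sub_addl | exact/ideal_addS/ideal_scaleS].
move=> M N iM iN QM MN _; split; first exact/ideal_addS/ideal_scaleS.
move=> NM x Nx.
have [q Qq [_ [r Mr <-] qrx]] : (Q <+> a *> M) (a * x).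
  by apply: NM; apply: sub_addr => //; exists x.
rewrite -[x](subrK r); apply: idlD => //; apply: QM => /=.
by rewrite mulrBr -qrx addrK.
Qed.

Definition fcol K := is_ideal K /\ exists n, is_len K [set: R] n.

(* Junk value 0 when [R / K] has infinite length. *)
Definition colen K : nat := xget 0%N [set n | is_len K [set: R] n].

Lemma colenP K : fcol K -> is_len K [set: R] (colen K).
Proof. by move=> [_ [n Kn]]; rewrite /colen; case: xgetP => // /(_ n). Qed.

Lemma colenE K n : is_len K [set: R] n -> colen K = n.
Proof. by move=> Kn; rewrite /colen; case: xgetP => [k _ Kk|/(_ n)//];
  exact: is_len_unique Kk Kn. Qed.

Lemma fcol_ideal K : fcol K -> is_ideal K. Proof. by case. Qed.

Lemma fcol_sub K L : fcol K -> is_ideal L -> K `<=` L -> fcol L.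
Proof.
move=> fK iL KL; split=> //; have [cn mn] := colenP fK.
apply: (@is_len_exists _ _ (colen K)) => // k ck; apply: mn.
rewrite -[k]add0n; apply: chain_cat ck.
by [].
Qed.

Lemma fcolT : fcol [set: R].
Proof.
split=> //; exists 0%N; split=> // -[|k] //= [_ [M [/chain_sub TM [_ ]]]].
by [].
Qed.

Lemma colenT : colen [set: R] = 0%N.
Proof. by apply: colenE; split=> // -[|k] //= [_ [M [/chain_sub TM []]]]. Qed.

Lemma is_len_sub K L : fcol K -> is_ideal L -> K `<=` L -> exists n,
  is_len K L n /\ colen K = (n + colen L)%N.
Proof.
move=> fK iL KL; have fL := fcol_sub fK iL KL; have iK := fcol_ideal fK.
have [n Ln] : exists n, is_len K L n.
  apply: (@is_len_exists _ _ (colen K)) => // k ck; have [_ mn] := colenP fK.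
  by apply: mn; exact: chain_widen ck.
by exists n; split=> //; apply: colenE; apply: is_len_add Ln (colenP fL).
Qed.

Lemma colen_le K L : fcol K -> is_ideal L -> K `<=` L -> (colen L <= colen K)%N.
Proof. by move=> fK iL KL; have [n [_ ->]] := is_len_sub fK iL KL; exact: leq_addl. Qed.

Lemma colen_inj K L : fcol K -> is_ideal L -> K `<=` L -> (colen K <= colen L)%N -> K = L.
Proof.
move=> fK iL KL; have iK := fcol_ideal fK.
have [n [[_ mn] ->]] := is_len_sub fK iL KL.
rewrite -[leqRHS]add0n leq_add2r leqn0 => /eqP n0.
apply/seteqP; split=> //; apply: contrapT => LK.
by have := mn 1%N; rewrite n0 => /(_ _)/wrap[]//; apply: chainS (chain0 iK) _.
Qed.

Lemma fcol_colon Q a : is_ideal Q -> fcol (Q <+> a *> [set: R]) -> fcol (Q :% a) -> fcol Q.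
Proof.
move=> iQ fQa fQc; split=> //; have [cn mn] := colenP fQc.
have Ql : is_len Q (Q <+> a *> [set: R]) (colen (Q :% a)).
  by split=> [|k]; [apply/chain_colon | move/chain_colon; auto].
by eexists; apply: is_len_add Ql (colenP fQa).
Qed.

Lemma colen_colon Q a : fcol Q ->
  colen Q = (colen (Q <+> a *> [set: R]) + colen (Q :% a))%N.
Proof.
move=> fQ; have iQ := fcol_ideal fQ.
have fQa : fcol (Q <+> a *> [set: R]) by apply: fcol_sub fQ _ _ => //; exact: sub_addl.
have fQc : fcol (Q :% a) by apply: fcol_sub fQ _ _ => //; exact: sub_colon.
have [cn mn] := colenP fQc.
rewrite addnC; apply: colenE; apply: is_len_add (colenP fQa) => //.
by split=> [|k]; [apply/chain_colon | move/chain_colon; auto].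
Qed.

Lemma colen_modular P Q : fcol P -> fcol Q ->
  fcol (P `&` Q) /\ (colen (P <+> Q) + colen (P `&` Q) = colen P + colen Q)%N.
Proof.
move=> fP fQ; have iP := fcol_ideal fP; have iQ := fcol_ideal fQ.
have [n [[cn mn] nE]] := is_len_sub fP (ideal_addP iP iQ) (@sub_addl _ P Q iQ).
have : is_len (P `&` Q) Q n.
  by split=> [|k]; [apply/chain_add_modular | move/chain_add_modular; auto].
move=> /is_len_add/(_ (colenP fQ))/wrap[]// nQ.
by split; [split=> //; eexists; exact: nQ | rewrite (colenE nQ) nE; lia].
Qed.

(** Multiplication by [a] is an isomorphism from (X + (Z : a)) / (Z : a) onto (aX + Z) / Z; the
    equality of lengths is written without subtraction. *)
Lemma colen_scale_add X Z a : fcol Z -> is_ideal X ->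
  (colen Z + colen (X <+> Z :% a) = colen (Z :% a) + colen (a *> X <+> Z))%N.
Proof.
move=> fZ iX; have iZ := fcol_ideal fZ.
have faXZ : fcol (a *> X <+> Z) by apply: fcol_sub fZ _ _ => //; exact: sub_addr.
rewrite (colen_colon a fZ) (colen_colon a faXZ).
have -> : (a *> X <+> Z) :% a = X <+> Z :% a.
  apply/seteqP; split=> [y [_ [x Xx <-] [z Zz xzy]]|_ [x Xx [y Zy <-]]].
    exists x => //; exists (y - x); last by rewrite addrC subrK.
    by rewrite /= mulrBr -xzy addrAC subrr add0r.
  by exists (a * x); [exists x | exists (a * y) => //; rewrite mulrDr].
have -> : a *> X <+> Z <+> a *> [set: R] = Z <+> a *> [set: R].
  rewrite -ideal_addA ideal_addC -ideal_addA [_ <+> a *> X]ideal_add_idr //.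
  exact: ideal_scaleS.
by lia.
Qed.

Lemma has_colengthP K n : is_ideal K -> has_colength K n <-> is_len K [set: R] n.
Proof.
move=> iK.
have toc k p : quot_chain K k p -> chain K [set: R] k.
  move=> [pP pS]; suff H i : (i <= k)%N -> chain K (p i) i by exact: chain_widen (H k _).
  elim: i => [|i IHi] ik; first by have [] := pP _ ik.
  have [iP _] := pP _ ik; apply: chainS (IHi (ltnW ik)) _ => //; exact: pS.
have fromc k L : chain K L k -> exists p, quot_chain K k p /\ p k = L.
  elim: k L => [|k IHk] L [iL].
    by move=> KL; exists (fun=> L); split=> //; split=> // i; rewrite leqn0 => /eqP ->.
  move=> [M [cM ML]]; have [p [[pP pS] pk]] := IHk _ cM.
  exists (fun i => if (i <= k)%N then p i else L); split; last by rewrite ltnn.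
  split=> i ik; first case: leqP => [/pP //|_].
    by split=> //; apply: subset_trans (chain_sub cM) _; case: ML.
  rewrite -ltnS ik; move: ik; rewrite ltnS leq_eqVlt => /orP[/eqP->|ik].
    by rewrite ltnn pk.
  by rewrite ik; exact: pS.
split=> [[[p /toc cn] mn]|[/fromc[p [pP _]] mn]]; split.
- by [].
- by move=> k /fromc[q [/mn]].
- by exists p.
- by move=> k q /toc/mn.
Qed.

Lemma has_colength_colen K n : fcol K -> has_colength K n <-> n = colen K.
Proof.
move=> fK; rewrite has_colengthP; last exact: fcol_ideal.
by split=> [/colenE //|->]; exact: colenP.
Qed.

End Length.

(** * Noetherian local rings *)

Section NoetherianLocal.
Variables (R : comNzRingType) (m : set R).
Hypotheses (noethR : is_noetherian R) (localR : is_local m).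
Implicit Types (A B C I J K L M P Q X Y Z : set R) (a b c x y z : R) (s : seq R).

Lemma ideal_gen_cons x s : ideal_gen [set` x :: s] = x *> [set: R] <+> ideal_gen [set` s].
Proof.
apply/seteqP; split.
  apply: ideal_gen_sub => // y; rewrite /= inE => /predU1P[->|ys].
    by apply: sub_addl => //; exact: ideal_scaleT.
  by apply: sub_addr => //; exact: sub_ideal_gen.
apply: ideal_add_sub => //.
  by apply: ideal_scale_sub => //; apply: sub_ideal_gen; rewrite /= mem_head.
by apply: ideal_gen_sub => // y ys; apply: sub_ideal_gen; rewrite /= inE orbC; apply/orP; left.
Qed.

Lemma ideal_gen_nil : ideal_gen [set` [::]] = [set 0 : R].
Proof.
apply/seteqP; split=> [|_ ->]; last exact: idl0.
apply: ideal_gen_sub => //; split=> //= [x y -> ->|a x ->]; first by rewrite addr0.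
by rewrite mulr0.
Qed.

Lemma noetherian_maximal (F : set (set R)) K : F `<=` @is_ideal R -> F K ->
  exists M, [/\ F M, K `<=` M & forall L, F L -> M `<=` L -> L = M].
Proof.
move=> FI FK; pose P : set (set R) := [set X | X = set0 \/ F X /\ K `<=` X].
have [G GP totG|A [PA maxA]] := @Zorn_bigcup _ P.
  have [G0|/existsNP[X /not_implyP[GX X0]]] := pselect (forall X, G X -> X = set0).
    by left; rewrite -subset0 => x [X /G0->].
  set U := \bigcup_(_ in G) _.
  have [//|[FX KX]] := GP X GX.
  have iX := FI _ FX; pose ne Y := G Y /\ X `<=` Y.
  have neP Y : ne Y -> F Y /\ is_ideal Y.
    move=> [GY XY]; have [Y0|[FY _]] := GP Y GY; last by split=> //; exact: FI.
    by have := idl0 iX => /XY; rewrite Y0.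
  have UP x : U x -> exists Y, ne Y /\ Y x.
    by move=> [Y GY Yx]; have [XY|YX] := totG _ _ GX GY; [exists Y | exists X; split;
      [split|exact: YX]].
  have iU : is_ideal U.
    split; first by exists X => //; exact: idl0.
      move=> x y /UP[Y [neY Yx]] /UP[Z [neZ Zy]].
      have [[_ iY] [_ iZ]] := (neP _ neY, neP _ neZ).
      have [YZ|ZY] := totG _ _ neY.1 neZ.1.
        by exists Z; [exact: neZ.1 | exact: idlD (YZ _ Yx) Zy].
      by exists Y; [exact: neY.1 | exact: idlD Yx (ZY _ Zy)].
    move=> a x /UP[Y [neY Yx]]; exists Y; first exact: neY.1.
    by apply: idlMl => //; exact: (neP _ neY).2.
  have [s sE] := noethR iU.
  have : [set` s] `<=` U by rewrite sE; exact: sub_ideal_gen.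
  suff : [set` s] `<=` U -> exists Y, ne Y /\ [set` s] `<=` Y.
    move=> /[apply] -[Y [neY sY]]; right; have [FY iY] := neP _ neY.
    suff -> : U = Y by split=> //; exact: subset_trans neY.2.
    apply/seteqP; split; last by move=> y Yy; exists Y => //; exact: neY.1.
    by rewrite sE; exact: ideal_gen_sub.
  elim: s {sE} => [|x s IHs] sU; first by exists X; split; [split|].
  have [|Y [neY sY]] := IHs; first by move=> y ys; apply: sU; rewrite /= inE orbC; apply/orP; left.
  have [|Z [neZ Zx]] := UP x; first by apply: sU; rewrite /= mem_head.
  have [YZ|ZY] := totG _ _ neY.1 neZ.1.
    exists Z; split=> // y; rewrite /= inE => /predU1P[->//|ys]; exact/YZ/sY.
  exists Y; split=> // y; rewrite /= inE => /predU1P[->//|ys]; [exact: ZY | exact: sY].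
have K0 := idl0 (FI _ FK).
case: PA => [A0|[FA KA]].
  have [] := maxA K; last by right; split.
  by rewrite A0; split=> // K0'; exact: (K0' _ K0).
exists A; split=> // L FL AL; apply/seteqP; split=> //.
apply: contrapT => LA; have [] := maxA L; last by right; split=> //; exact: subset_trans AL.
by split.
Qed.

Let imax : is_maximal m. Proof. by case: localR. Qed.

Lemma local_ideal : is_ideal m. Proof. by case: imax. Qed.

Lemma local_notin1 : ~ m 1. Proof. by case: imax. Qed.

Lemma local_unit x : ~ m x -> exists u, x * u = 1.
Proof.
move=> mx; apply: contrapT => xnu.
have [||M [[iM M1] xM maxM]] :=
  @noetherian_maximal [set K | is_ideal K /\ ~ K 1] (x *> [set: R]).
- by move=> K [].
- by split=> // -[u _ xu]; apply: xnu; exists u.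
apply: mx; rewrite -[m](localR.2 M); first exact/xM/ideal_scaleT.
by split=> // K iK MK K1; apply: maxM.
Qed.

Lemma local_sub1_unit x r : m x -> exists u, (1 - x * r) * u = 1.
Proof.
move=> mx; apply: local_unit => m1; apply: local_notin1.
rewrite -[1](subrK (x * r)); apply: idlD => //; first exact: local_ideal.
exact: (idlMr _ local_ideal).
Qed.

Lemma local_prime : is_prime m.
Proof.
split; [exact: local_ideal | exact: local_notin1 |] => x y mxy.
have [|/local_unit[u xu]] := pselect (m x); [by left | right].
rewrite -[y]mul1r -xu mulrAC mulrC; exact: (idlMl _ local_ideal).
Qed.

Lemma chain_local n : chain m [set: R] n -> (n <= 1)%N.
Proof.
case: n => [|[|n]] // [_ [M [[iM [M' [cM' [M'M MM']]]] [_ TM]]]].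
exfalso; apply: MM'; have mM' := chain_sub cM'.
have [_ _ maxm] := imax; rewrite (maxm M) //; first exact: subset_trans mM' M'M.
by move=> /(ideal_eqT iM) MT; apply: TM; rewrite MT.
Qed.

End NoetherianLocal.

(** * Ideals of finite colength, parameters, Nakayama's lemma *)

Section FiniteColength.
Variables (R : comNzRingType) (m : set R).
Hypotheses (noethR : is_noetherian R) (localR : is_local m).
Implicit Types (A B C I J K L M P Q X Y Z : set R) (a b c x y z : R) (s : seq R).

Lemma fcol_local : fcol m.
Proof.
have im := local_ideal localR; split=> //.
by apply: (@is_len_exists _ _ _ 1) => // k; exact: (chain_local localR).
Qed.

Lemma colen_local : (colen m <= 1)%N.
Proof. by apply: (chain_local localR); case: (colenP fcol_local). Qed.

Lemma fcol_gens Q s : is_ideal Q ->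
  (forall x K, x \in s -> is_ideal K -> Q `<=` K -> fcol (K <+> x *> [set: R]) -> fcol K) ->
  fcol (Q <+> ideal_gen [set` s]) -> fcol Q.
Proof.
elim: s Q => [|x s IHs] Q iQ sQ.
  by rewrite ideal_gen_nil ideal_add_idr //; [rewrite -ideal_gen_nil | move=> _ ->; exact: idl0].
rewrite ideal_gen_cons ideal_addA => /IHs fQx.
apply: (sQ x) => //; first by rewrite mem_head.
apply: fQx => // y K ys iK QK; apply: sQ => //; first by rewrite inE ys orbT.
by apply: subset_trans QK; exact: sub_addl.
Qed.

Lemma fcol_mul A B : fcol A -> fcol B -> fcol (A <**> B).
Proof.
move=> fA fB; have [s sE] := noethR (fcol_ideal fB).
apply: (@fcol_gens _ s) => //; last first.
  by apply: fcol_sub fB _ _ => //; rewrite -sE; apply: sub_addr.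
move=> x K xs iK AK fKx; apply: fcol_colon fKx _ => //.
apply: fcol_sub fA _ _ => // y Ay /=; apply: AK; rewrite mulrC; apply: mem_ideal_mul => //.
by rewrite sE; exact: sub_ideal_gen.
Qed.

Lemma fcol_pow A n : fcol A -> fcol (A ^^ n).
Proof. by move=> fA; elim: n => [|n IHn]; [exact: fcolT | exact: fcol_mul]. Qed.

(** Finite colength passes from Q + x^n R to Q + x^(n+1) R, because the colon of the latter by x^n
    contains Q + xR. *)
Lemma fcol_adjoin_nil Q x n : is_ideal Q -> fcol (Q <+> x *> [set: R]) -> Q (x ^+ n) -> fcol Q.
Proof.
move=> iQ fQx Qxn.
have Qx : Q <+> x ^+ n *> [set: R] = Q by apply: ideal_add_idr => //; exact: ideal_scale_sub.
rewrite -Qx; elim: n {Qxn Qx} => [|n IHn].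
  apply: fcol_sub (@fcolT R) _ _ => // y _; apply: sub_addr => //; exists y => //.
  by rewrite expr0 mul1r.
set K := Q <+> _; have iK : is_ideal K by [].
apply: (@fcol_colon _ _ (x ^+ n)) => //.
  apply: fcol_sub IHn _ _ => //; apply: ideal_addS => //; exact: sub_addl.
apply: fcol_sub fQx _ _ => //; apply: ideal_add_sub => // y.
  by move=> Qy; apply: sub_addl => //; exact: idlMl.
move=> [r _ <-] /=; apply: sub_addr => //; exists r => //.
by rewrite exprSr mulrA.
Qed.

Lemma fcol_radical Q : is_ideal Q -> (forall x, m x -> exists n, Q (x ^+ n)) -> fcol Q.
Proof.
move=> iQ mQ; have [s sE] := noethR (local_ideal localR).
apply: (@fcol_gens _ s) => //; last first.
  by apply: fcol_sub fcol_local _ _ => //; rewrite {1}sE; exact: sub_addr.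
move=> x K xs iK QK fKx; have [|n Qxn] := mQ x; first by rewrite sE; exact: sub_ideal_gen.
by apply: fcol_adjoin_nil fKx _ => //; exact: QK Qxn.
Qed.

(** Otherwise the ideals Q + x^n R decrease strictly: x^n in Q + x^(n+1) R would put x^n (1 - x r)
    in Q for a unit 1 - x r. Their colengths are bounded by that of Q. *)
Lemma fcol_has_pow Q x : fcol Q -> m x -> exists n, Q (x ^+ n).
Proof.
move=> fQ mx; have iQ := fcol_ideal fQ; apply: contrapT => nQ.
pose K n := Q <+> x ^+ n *> [set: R].
have fK n : fcol (K n) by apply: fcol_sub fQ _ _ => //; exact: sub_addl.
have KS n : K n.+1 `<=` K n.
  by apply: ideal_addS => // _ [r _ <-]; exists (x * r) => //; rewrite exprSr mulrA.
have lt n : (colen (K n) < colen (K n.+1))%N.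
  rewrite ltnNge; apply/negP => /(colen_inj (fK _) (fcol_ideal (fK n)) (KS n)) KE.
  have : K n (x ^+ n) by apply: sub_addr => //; exact: ideal_scaleT.
  rewrite -KE => -[q Qq [_ [r _ <-] qE]].
  have [u xru] := local_sub1_unit noethR localR r mx.
  apply: nQ; exists n; rewrite -[x ^+ n]mulr1 -xru mulrA; apply: idlMr => //.
  suff -> : x ^+ n * (1 - x * r) = q by [].
  by rewrite mulrBr mulr1 mulrA -exprSr -[in X in X - _]qE addrK.
have leK n : (n <= colen (K n))%N by elim: n => // n IHn; exact: leq_ltn_trans (lt n).
have := leK (colen Q).+1; rewrite leqNgt ltnS.
by rewrite colen_le //; exact: sub_addl.
Qed.

(* An ideal maximal among those containing [Q] and avoiding all [u y^n] with [u] outside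
   [P] is prime. *)
Lemma prime_below Q P y : is_ideal Q -> is_prime P -> Q `<=` P -> P y ->
  (forall u, Q (y * u) -> Q u) -> exists P', [/\ is_prime P', Q `<=` P' & P' `<` P].
Proof.
move=> iQ [iP P1 PM] QP Py Qy.
pose F : set (set R) := [set K | [/\ is_ideal K, Q `<=` K & forall u n, K (u * y ^+ n) -> P u]].
have [||M [[iM QM MP] _ maxM]] := @noetherian_maximal R noethR F Q.
- by move=> K [].
- split=> // u n; elim: n => [|n IHn]; first by rewrite mulr1; exact: QP.
  by rewrite exprS mulrCA => /Qy.
have adj u : ~ M u -> exists v n, [/\ ~ P v & (M <+> u *> [set: R]) (v * y ^+ n)].
  move=> Mu; apply: contrapT => nex; apply: Mu.
  have iMu : is_ideal (M <+> u *> [set: R]) by [].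
  rewrite -(maxM (M <+> u *> [set: R])); first by apply: sub_addr => //; exact: ideal_scaleT.
    split=> //; first by apply: subset_trans QM _; exact: sub_addl.
    by move=> v n Mv; apply: contrapT => Pv; apply: nex; exists v, n.
  exact: sub_addl.
have MP' : M `<=` P by move=> x; rewrite -[x in M x]mulr1 -(expr0 y); exact: MP.
exists M; split=> //; last first.
  split=> // PM'; apply: P1; apply: (MP 1 1%N); rewrite mul1r; exact: PM'.
split=> // [/MP' //|u v Muv]; apply: contrapT => /not_orP[/adj[w [k [Pw Mw]]] /adj[w' [k' [Pw'
  Mw']]]].
suff /MP/PM[] : M (w * w' * y ^+ (k + k')) by [].
rewrite exprD mulrACA.
move: Mw Mw' => [p Mp [_ [r _ <-] <-]] [p' Mp' [_ [r' _ <-] <-]].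
have -> : (p + u * r) * (p' + v * r') = p * (p' + v * r') + u * r * p' + r * r' * (u * v) by ring.
by apply: idlD => //; [apply: idlD => //; [exact: idlMr | exact: idlMl] | exact: idlMl].
Qed.

(* An ideal maximal among those of infinite colength is prime. *)
Lemma fcol_of_primes Q : is_ideal Q -> (forall P, is_prime P -> Q `<=` P -> P = m) -> fcol Q.
Proof.
move=> iQ Qm; apply: contrapT => nQ.
pose F : set (set R) := [set K | [/\ is_ideal K, Q `<=` K & ~ fcol K]].
have [||M [[iM QM nM] _ maxM]] := @noetherian_maximal R noethR F Q.
- by move=> K [].
- by split.
have adj K : is_ideal K -> M `<=` K -> ~ K `<=` M -> fcol K.
  move=> iK MK KM; apply: contrapT => nK; apply: KM; rewrite (maxM K) //.
  by split=> //; exact: subset_trans MK.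
apply: (nM); suff /Qm-> : is_prime M by [exact: fcol_local | exact: QM].
split=> // [M1|u v Muv]; first by apply: nM; rewrite (ideal_eqT iM M1); exact: fcolT.
apply: contrapT => /not_orP[Mu Mv]; apply: nM; apply: (@fcol_colon _ _ u) => //.
  apply: adj => //; first exact: sub_addl.
  by move=> H; apply: Mu; apply: H; apply: sub_addr => //; exact: ideal_scaleT.
by apply: adj => // [|H]; [exact: sub_colon | apply: Mv; apply: H].
Qed.

Definition regular_pair x y :=
  (forall u, x * u = 0 -> u = 0) /\
  (forall u, (x *> [set: R]) (y * u) -> (x *> [set: R]) u).

(** A prime P other than m containing x and y would allow two descents by [prime_below], the first
    because y is regular modulo x, the second because x is regular. Together with m this is a chain
    of length three, which dimension two excludes. *)
Lemma regular_parameters : is_cohen_macaulay m -> has_krull_dim R 2 ->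
  exists x y, [/\ m x, m y, regular_pair x y & fcol (x *> [set: R] <+> y *> [set: R])].
Proof.
move=> [d [[p pd] dmax] [[s [sreg sm sd]] _]] [[q qd] qmax].
have d2 : d = 2%N by apply/eqP; rewrite eqn_leq (qmax d p) // (dmax 2%N q).
case: s sreg sm sd => [|x [|y [|z s]]]; rewrite d2 // => -[sreg s1] sm _.
have mx : m x by apply: sm; rewrite /= !inE eqxx.
have my : m y by apply: sm; rewrite /= !inE eqxx orbT.
have xreg u : x * u = 0 -> u = 0.
  have := sreg 0%N isT u; rewrite /= ideal_gen_nil /=; exact.
have yreg u : (x *> [set: R]) (y * u) -> (x *> [set: R]) u.
  have := sreg 1%N isT u; rewrite /= ?take0 ideal_gen_cons ideal_gen_nil ideal_add_idr //.
  - by rewrite -ideal_gen_nil.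
  - by move=> _ ->; exact: idl0.
exists x, y; split=> //; apply: fcol_of_primes => // P pP xyP.
apply: contrapT => Pm; have [iP P1 _] := pP.
have mP : P `<` m.
  suff Pm' : P `<=` m by split=> // mP; apply: Pm; exact/seteqP.
  move=> z Pz; apply: contrapT => /(local_unit noethR localR)[u zu].
  by apply: P1; rewrite -zu; exact: idlMr.
have ixR : is_ideal (x *> [set: R]) by [].
have xP : x *> [set: R] `<=` P by apply: subset_trans xyP; exact: sub_addl.
have Py : P y by apply: xyP; apply: sub_addr => //; exact: ideal_scaleT.
have [P' [pP' xP' P'P]] := prime_below ixR pP xP Py yreg.
have i0 : is_ideal [set 0 : R] by rewrite -ideal_gen_nil.
have P'0 : [set 0] `<=` P' by move=> _ ->; apply: idl0; case: pP'.
have [P'' [pP'' _ P''P']] := prime_below i0 pP' P'0 (xP' _ (ideal_scaleT x)) xreg.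
have := qmax 3%N (fun i => match i with 0 => P'' | 1 => P' | 2 => P | _ => m end)%N.
case/(_ _)/wrap => //; split; first by move=> [|[|[|i]]] // _; exact: (local_prime noethR localR).
by move=> [|[|[|i]]].
Qed.

Lemma nakayama X Y : is_ideal X -> is_ideal Y -> X `<=` Y <+> m <**> X -> X `<=` Y.
Proof.
move=> iX iY XYm; have im := local_ideal localR; have [s sE] := noethR iX.
suff H (t : seq R) : [set` t] `<=` X -> X `<=` Y <+> m <**> ideal_gen [set` t] -> X `<=` Y.
  by apply: (H s); rewrite -?sE // sE; exact: sub_ideal_gen.
elim: t => [|x t IHt] tX Xt.
  apply: subset_trans Xt _; apply: ideal_add_sub => //.
  apply: ideal_mul_sub => // u v _; rewrite ideal_gen_nil => ->; rewrite mulr0; exact: idl0.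
have tX' : [set` t] `<=` X by move=> y yt; apply: tX; rewrite /= inE orbC; apply/orP; left.
have Xx : X x by apply: tX; rewrite /= mem_head.
apply: IHt => //; move: Xt; rewrite ideal_gen_cons ideal_mulDr // ideal_mul_scale ideal_mulT //.
rewrite ideal_addA -[Y <+> _ <+> _]ideal_addA [x *> m <+> _]ideal_addC ideal_addA.
set Z := Y <+> _ => Xt; have iZ : is_ideal Z by [].
suff Zx : Z x by apply: subset_trans Xt _; apply: ideal_add_sub => //; exact: ideal_scale_sub.
have [z Zz [_ [r mr <-] zx]] := Xt x Xx.
have [u ru] := local_sub1_unit noethR localR 1 mr.
rewrite -[x]mulr1 -ru mulrA mulr1; apply: idlMr => //.
suff -> : x * (1 - r) = z by [].
by rewrite mulrBr mulr1 -[in X in X - _]zx addrK.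
Qed.

End FiniteColength.

(** * Regular pairs and Koszul relations *)

Section Koszul.
Variables (R : comNzRingType) (m : set R).
Hypotheses (noethR : is_noetherian R) (localR : is_local m).
Implicit Types (A B C I J K L M P Q X Y Z : set R) (a b c x y z : R) (s : seq R).

(** Vanishing of the first Koszul homology of [a], [b]. *)
Definition koszul a b :=
  forall u v, a * u = b * v -> exists t, u = b * t /\ v = a * t.

Lemma koszul_sym a b : koszul a b -> koszul b a.
Proof. by move=> kab u v /esym/kab[t [vt ut]]; exists t. Qed.

Lemma regular_pair_pow x y n k : regular_pair x y -> regular_pair (x ^+ n) (y ^+ k).
Proof.
move=> [xreg yreg]; split.
  by elim: n => [|n IHn] u; rewrite ?mul1r // exprS -mulrA => /xreg/IHn.
suff yn u : (x ^+ n *> [set: R]) (y * u) -> (x ^+ n *> [set: R]) u.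
  elim: k => [|k IHk] u; first by rewrite mul1r.
  by rewrite exprS -mulrA => /yn/IHk.
elim: n u => [|n IHn] u; first by move=> _; exists u; rewrite ?mul1r.
move=> [r _ rE].
have [u' _ uE] : (x *> [set: R]) u.
  by apply: yreg; exists (x ^+ n * r) => //; rewrite mulrA -exprS.
have [r' _ rE'] : (x ^+ n *> [set: R]) u'.
  apply: IHn; exists r => //; apply/eqP; rewrite -subr_eq0; apply/eqP/xreg.
  by rewrite mulrBr mulrA -exprS rE -uE; ring.
by exists r' => //; rewrite exprS -mulrA rE'.
Qed.

(* Depth sensitivity of the Koszul complex: a relation [a u = b v], multiplied by a
   regular pair taken from [(a, b)], becomes a multiple of the trivial relation. *)
Lemma koszul_regular x y a b : regular_pair x y ->
  (a *> [set: R] <+> b *> [set: R]) x -> (a *> [set: R] <+> b *> [set: R]) y ->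
  koszul a b.
Proof.
move=> [xreg yreg] [_ [p _ <-] [_ [q _ <-] xE]] [_ [r _ <-] [_ [s _ <-] yE]] u v uv.
pose w := p * v + q * u; pose w' := r * v + s * u.
have xu : x * u = b * w.
  by rewrite -xE /w !mulrDl !mulrDr [a * p * u]mulrAC uv; ring.
have xv : x * v = a * w.
  by rewrite -xE /w !mulrDl !mulrDr [b * q * v]mulrAC -uv; ring.
have yu : y * u = b * w'.
  by rewrite -yE /w' !mulrDl !mulrDr [a * r * u]mulrAC uv; ring.
have yv : y * v = a * w'.
  by rewrite -yE /w' !mulrDl !mulrDr [b * s * v]mulrAC -uv; ring.
have bw : b * (y * w - x * w') = 0.
  by rewrite mulrBr [b * (y * w)]mulrCA -xu [b * (x * w')]mulrCA -yu; ring.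
have aw : a * (y * w - x * w') = 0.
  by rewrite mulrBr [a * (y * w)]mulrCA -xv [a * (x * w')]mulrCA -yv; ring.
have /eqP : y * w - x * w' = 0.
  apply: xreg; rewrite -{1}xE.
  have -> : (a * p + b * q) * (y * w - x * w') =
    p * (a * (y * w - x * w')) + q * (b * (y * w - x * w')) by ring.
  by rewrite aw bw !mulr0 addr0.
rewrite subr_eq0 => /eqP ww'.
have [t _ wE] : (x *> [set: R]) w by apply: yreg; exists w'.
exists t; split; apply/eqP; rewrite -subr_eq0; apply/eqP/xreg.
  by rewrite mulrBr xu -wE; ring.
by rewrite mulrBr xv -wE; ring.
Qed.

Lemma ideal_scale_absorb a A B : is_ideal A -> is_ideal B ->
  a *> A <+> B <+> a *> [set: R] = a *> [set: R] <+> B.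
Proof.
move=> iA iB; rewrite ideal_addC ideal_addA [a *> _ <+> a *> A]ideal_add_idr //.
exact: ideal_scaleS.
Qed.

Lemma fcol_koszul_add a b A B : fcol (a *> [set: R] <+> b *> [set: R]) ->
  fcol A -> fcol B -> fcol (a *> A <+> b *> B).
Proof.
move=> fab fA fB; have iA := fcol_ideal fA; have iB := fcol_ideal fB.
apply: (@fcol_colon _ _ a) => //.
  rewrite ideal_scale_absorb //; apply: (@fcol_colon _ _ b) => //.
    apply: fcol_sub fab _ _ => //; apply: ideal_addS => //; exact: sub_addl.
  apply: fcol_sub fB _ _ => // x Bx; apply: sub_addr => //; by exists x.
by apply: fcol_sub fA _ _ => // x Ax; apply: sub_addl => //; exists x.
Qed.

(** Additivity of length in the exact sequence 0 -> R / ((A : b) ∩ (B : a)) -> R/A + R/B -> (a, b) /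
    (aA + bB) -> 0, with t sent to (b t, - a t) and (u, v) to a u + b v. The proof replaces the
    direct sum by successive colons with respect to [a] and [b]. *)
Lemma colen_koszul a b A B : koszul a b -> fcol (a *> [set: R] <+> b *> [set: R]) ->
  fcol A -> fcol B ->
  (colen (a *> A <+> b *> B) + colen ((A :% b) `&` (B :% a)) =
   colen (a *> [set: R] <+> b *> [set: R]) + colen A + colen B)%N.
Proof.
move=> kab fab fA fB; have iA := fcol_ideal fA; have iB := fcol_ideal fB.
have fQ := fcol_koszul_add fab fA fB.
have fAb : fcol (A :% b) by apply: fcol_sub fA _ _ => //; exact: sub_colon.
have fBa : fcol (B :% a) by apply: fcol_sub fB _ _ => //; exact: sub_colon.
have [_ modE] := colen_modular fAb fBa.
have fAB : fcol (A <+> b *> (B :% a)) by apply: fcol_sub fA _ _ => //; exact: sub_addl.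
have faB : fcol (a *> [set: R] <+> b *> B).
  apply: fcol_sub fQ _ _ => //; apply: ideal_addS => //; exact: ideal_scaleS.
have QE : (a *> A <+> b *> B) :% a = A <+> b *> (B :% a).
  apply/seteqP; split=> [y [_ [x Ax <-] [_ [z Bz <-] yE]]|_ [x Ax [_ [z Bz <-] <-]]].
    have [|t [ytE zE]] := kab (y - x) z; first by rewrite mulrBr -yE addrAC subrr add0r.
    exists x => //; exists (y - x); last by rewrite addrC subrK.
    by exists t; [rewrite /= -zE | rewrite -ytE].
  exists (a * x); first by exists x.
  by exists (b * (a * z)); [exists (a * z) | ring].
have abE : (a *> [set: R] <+> b *> B) :% b = B <+> a *> [set: R].
  apply/seteqP; split=> [y [_ [x _ <-] [_ [z Bz <-] yE]]|_ [x Bx [_ [z _ <-] <-]]].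
    have [|t [ytE zE]] := koszul_sym kab (u := y - z) (v := x).
      by rewrite mulrBr -yE addrK.
    exists z => //; exists (y - z); last by rewrite addrC subrK.
    by exists t; rewrite -?ytE.
  exists (a * (b * z)); first by exists (b * z).
  by exists (b * x); [exists x | ring].
have ABE : (A <+> b *> (B :% a)) :% b = A :% b <+> B :% a.
  apply/seteqP; split=> [y [x Ax [_ [z Bz <-] yE]]|_ [x Ax [z Bz <-]]].
    exists (y - z); last by exists z => //; rewrite subrK.
    by rewrite /= mulrBr -yE addrK.
  by exists (b * x) => //; exists (b * z); [exists z | ring].
rewrite (colen_colon a fQ) QE (colen_colon b fAB) ABE.
rewrite ideal_scale_absorb // (colen_colon b faB) abE.
have -> : A <+> b *> (B :% a) <+> b *> [set: R] = A <+> b *> [set: R].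
  by rewrite [A <+> _]ideal_addC ideal_scale_absorb // ideal_addC.
have -> : a *> [set: R] <+> b *> B <+> b *> [set: R] = a *> [set: R] <+> b *> [set: R].
  by rewrite [_ <+> b *> B]ideal_addC ideal_scale_absorb // ideal_addC.
rewrite (colen_colon b fA) (colen_colon a fB).
by move: modE; do 7! move: (colen _); lia.
Qed.

Lemma fcol_pair_pow a b n k : fcol (a *> [set: R] <+> b *> [set: R]) ->
  fcol (a ^+ n *> [set: R] <+> b ^+ k *> [set: R]).
Proof.
move=> fab; have an : fcol (a ^+ n *> [set: R] <+> b *> [set: R]).
  apply: (@fcol_adjoin_nil _ _ a n) => //; last by apply: sub_addl => //; exact: ideal_scaleT.
  apply: fcol_sub fab _ _ => //; rewrite ideal_addC; apply: ideal_addS => //; exact: sub_addr.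
apply: (@fcol_adjoin_nil _ _ b k) => //; last by apply: sub_addr => //; exact: ideal_scaleT.
apply: fcol_sub an _ _ => //; apply: ideal_addS => //; exact: sub_addl.
Qed.

Hypothesis parR : exists x y,
  [/\ m x, m y, regular_pair x y & fcol (x *> [set: R] <+> y *> [set: R])].

(** In a Cohen-Macaulay ring systems of parameters are regular: (a, b) contains powers of the given
    regular pair, and these are again a regular pair. *)
Lemma fcol_koszul a b : fcol (a *> [set: R] <+> b *> [set: R]) -> koszul a b.
Proof.
move=> fab; have [x [y [mx my xy _]]] := parR.
have [n xn] := fcol_has_pow noethR localR fab mx.
have [k yk] := fcol_has_pow noethR localR fab my.
exact: koszul_regular (regular_pair_pow n k xy) xn yk.
Qed.

(** By [colen_koszul] for the ideals (a^j, b) and R, each further factor of one element adds the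
    colength of (a, b) once. *)
Lemma colen_pair_pow a b n k : fcol (a *> [set: R] <+> b *> [set: R]) ->
  colen (a ^+ n *> [set: R] <+> b ^+ k *> [set: R]) =
  (n * k * colen (a *> [set: R] <+> b *> [set: R]))%N.
Proof.
have step a' b' j : fcol (a' *> [set: R] <+> b' *> [set: R]) ->
    colen (a' ^+ j *> [set: R] <+> b' *> [set: R]) =
    (j * colen (a' *> [set: R] <+> b' *> [set: R]))%N.
  move=> fab; elim: j => [|j IHj].
    rewrite (@ideal_eqT _ (_ <+> _)) ?colenT //; apply: sub_addl => //.
    exact: ideal_scaleT.
  have fj : fcol (a' ^+ j *> [set: R] <+> b' *> [set: R]) := fcol_pair_pow j 1 fab.
  have := colen_koszul (fcol_koszul fab) fab fj (@fcolT R).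
  rewrite (@ideal_eqT _ (_ `&` _)) ?colenT //; last first.
    by split=> //=; rewrite mulr1; apply: sub_addr => //; exact: ideal_scaleT.
  have -> : a' *> (a' ^+ j *> [set: R] <+> b' *> [set: R]) <+> b' *> [set: R] =
      a' ^+ j.+1 *> [set: R] <+> b' *> [set: R].
    apply/seteqP; split.
      apply: ideal_add_sub => //; last exact: sub_addr.
      move=> _ [_ [_ [r _ <-] [_ [s _ <-] <-]] <-]; rewrite mulrDr mulrA -exprS.
      exists (a' ^+ j.+1 * r); first by exists r.
      by exists (a' * (b' * s)) => //; exists (a' * s); rewrite // mulrCA.
    apply: ideal_addS => // _ [r _ <-]; rewrite exprS -mulrA; exists (a' ^+ j * r) => //.
    by apply: sub_addl => //; exists r.
  by move=> H; rewrite mulSn -IHj; lia.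
move=> fab; rewrite step; last exact: (fcol_pair_pow 1 k fab).
rewrite ideal_addC step; last by rewrite ideal_addC.
by rewrite mulnA [b *> _ <+> _]ideal_addC.
Qed.

End Koszul.

(** * Generic elements and joint reductions *)

Definition ev (P : nat -> Prop) := exists N, forall t, (N <= t)%N -> P t.

Lemma ev_and (P Q : nat -> Prop) : ev P -> ev Q -> ev (fun t => P t /\ Q t).
Proof.
by move=> [N NP] [N' NQ]; exists (maxn N N') => t; rewrite geq_max => /andP[/NP ? /NQ].
Qed.

Lemma ev_mono (P Q : nat -> Prop) : (forall t, P t -> Q t) -> ev P -> ev Q.
Proof. by move=> PQ [N NP]; exists N => t /NP/PQ. Qed.

Lemma ev_seq (P : nat -> nat -> Prop) (ts : seq nat) :
  (forall t, t \in ts -> ev (P t)) -> ev (fun u => forall t, t \in ts -> P t u).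
Proof.
elim: ts => [|t ts IHts] Pts; first by exists 0%N.
have evt := Pts t (mem_head _ _).
have /IHts evts : forall u, u \in ts -> ev (P u) by move=> u uts; apply: Pts; rewrite inE uts orbT.
by apply: ev_mono (ev_and evt evts) => u [Ptu Pu] v; rewrite inE => /predU1P[->|/Pu].
Qed.

Lemma not_ev (P : nat -> Prop) : ~ ev P -> forall N, exists t, (N <= t)%N /\ ~ P t.
Proof.
move=> nP N; apply: contrapT => nt; apply: nP; exists N => t Nt.
by apply: contrapT => Pt; apply: nt; exists t.
Qed.

Section GenericElements.
Variables (R : comNzRingType) (m : set R).
Hypotheses (noethR : is_noetherian R) (localR : is_local m).
Implicit Types (A B C I J K L M P Q X Y Z : set R) (x y z : R) (a b : nat -> R).

(** A family in general position. If a condition fails for infinitely many members, then already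
    finitely many of the failing members generate [A]; cofinite sets of indices thus play the role
    of nonempty open sets. *)
Definition generating A a := (forall t, A (a t)) /\
  exists g, forall ts, uniq ts -> size ts = g ->
    A `<=` ideal_gen [set x | exists2 t, t \in ts & x = a t].

Lemma infinite_residue_seq : infinite_residue_field m ->
  exists tau : nat -> R, forall i j, (i < j)%N -> ~ m (tau j - tau i).
Proof.
have im := local_ideal localR.
move=> /infiniteP/pcard_leP[f].
have /choice[tau tauP] : forall i, exists x, [set y | m (y - x)] = f i.
  by move=> i; have [x _ <-] := @funS _ _ _ _ f i Logic.I; exists x.
exists tau => i j ij mij; suff ji : j = i by rewrite ji ltnn in ij.
apply: (@inj _ _ _ f); rewrite ?inE //.
apply: etrans (etrans (esym (tauP j)) _) (tauP i).
apply/seteqP; split=> y /= my.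
  have -> : y - tau i = (y - tau j) + (tau j - tau i) by ring.
  exact: idlD.
have -> : y - tau j = (y - tau i) - (tau j - tau i) by ring.
exact: idlB.
Qed.

(* The generic elements lie on the moment curve [\sum_i s_i tau^i] in the generators [s_i]
   of [A], so a Vandermonde determinant shows that any [size s] of them generate [A]. *)
Lemma generating_exists A : infinite_residue_field m -> is_ideal A ->
  exists a, generating A a.
Proof.
move=> /infinite_residue_seq[tau tauP] iA; have [s sE] := noethR iA.
have As i : A s`_i.
  have [si|si] := ltnP i (size s); last by rewrite nth_default //; exact: idl0.
  by rewrite sE; apply: sub_ideal_gen; rewrite /= mem_nth.
pose a t := \sum_(i < size s) s`_i * tau t ^+ i.
have Aa t : A (a t).
  by rewrite /a; elim/big_ind: _ => [|x y|i _]; [exact: idl0 | exact: idlD | exact: idlMr].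
exists a; split=> //; exists (size s) => ts uts tss.
set G := ideal_gen _; have iG : is_ideal G by [].
pose v : 'rV[R]_(size s) := \row_j tau (nth 0%N (sort leq ts) j).
pose V := Vandermonde (size s) v.
pose r : 'rV[R]_(size s) := \row_i s`_i.
have sts : size (sort leq ts) = size s by rewrite size_sort.
have rV j : (r *m V) 0 j = a (nth 0%N (sort leq ts) j).
  by rewrite mxE /a; apply: eq_bigr => i _; rewrite !mxE.
have Gr j : G (\det V * s`_j).
  have [js|js] := ltnP j (size s); last by rewrite nth_default // mulr0; exact: idl0.
  have -> : \det V * s`_j = (r *m V *m \adj V) 0 (Ordinal js).
    by rewrite -mulmxA mul_mx_adj mul_mx_scalar !mxE.
  rewrite mxE; elim/big_ind: _ => [|x y|i _]; [exact: idl0 | exact: idlD |].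
  apply: (@idlMr _ G _ _ iG); rewrite rV; apply: sub_ideal_gen.
  by exists (nth 0%N (sort leq ts) i); rewrite // -(mem_sort leq) mem_nth // sts.
have pm := local_prime noethR localR.
have [|u du] := local_unit noethR localR (x := \det V).
  rewrite det_Vandermonde; case: pm => _ m1 mM.
  elim/big_ind: _ => // [x y mx my /mM[]//|i _].
  elim/big_ind: _ => // [x y mx my /mM[]//|j ij].
  rewrite !mxE; apply: tauP.
  have := sort_sorted leq_total ts; rewrite sorted_pairwise; last exact: leq_trans.
  move=> /(pairwiseP 0%N)/(_ i j); rewrite !inE sts !ltn_ord => /(_ isT isT ij).
  rewrite leq_eqVlt => /orP[|//]; rewrite nth_uniq ?sts ?sort_uniq //.
  by move=> /eqP ijE; rewrite ijE ltnn in ij.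
rewrite sE; apply: ideal_gen_sub => // x /= /(nthP 0)[i _ <-].
by rewrite -[s`_i]mul1r -du mulrAC; apply: (@idlMr _ G _ _ iG).
Qed.

Lemma generating_infinite A a (T : nat -> Prop) : generating A a ->
  (forall N, exists t, (N <= t)%N /\ T t) ->
  exists ts : seq nat, (forall t, t \in ts -> T t) /\
    A `<=` ideal_gen [set x | exists2 t, t \in ts & x = a t].
Proof.
move=> [_ [g gP]] infT.
suff [ts [uts tss tsT]] : exists ts : seq nat,
    [/\ uniq ts, size ts = g & forall t, t \in ts -> T t] by exists ts; split=> //; exact: gP.
elim: {gP} g => [|g [ts [uts tss tsT]]]; first by exists [::].
have [t [tts Tt]] := infT (\max_(i <- ts) i).+1.
exists (t :: ts); split=> /=; rewrite ?tss //.
  rewrite uts andbT; apply/negP => tin; move: tts.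
  by rewrite ltnNge (@leq_bigmax_seq _ ts xpredT id t tin isT).
by move=> u; rewrite inE => /predU1P[->|/tsT].
Qed.

Lemma generating_mul_sub A a Y K (ts : seq nat) : is_ideal Y -> is_ideal K ->
  A `<=` ideal_gen [set x | exists2 t, t \in ts & x = a t] ->
  (forall t, t \in ts -> a t *> Y `<=` K) -> A <**> Y `<=` K.
Proof.
move=> iY iK Ats tsK; apply: ideal_mul_sub => // x y /Ats Gx Yy; rewrite mulrC.
suff : ideal_gen [set x | exists2 t, t \in ts & x = a t] `<=` K :% y by exact.
apply: ideal_gen_sub => // _ [t /tsK tK ->] /=.
by apply: tK; exists y => //; rewrite mulrC.
Qed.

(* Eakin-Sathaye: if cofinitely many [b t] do not work, then finitely many of them
   generate [J], and the claim for each of the colon ideals [Z : b t], whose relative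
   length is smaller, gives the claim for [Z]. *)
Lemma eakin_sathaye1 (Y : nat -> set R) J b q Z :
  (forall i, is_ideal (Y i)) -> (forall i, Y i.+1 = J <**> Y i) -> generating J b ->
  fcol Z -> (colen Z <= colen (Y q <+> Z) + q)%N ->
  ev (fun t => Y q `<=` b t *> Y q.-1 <+> Z).
Proof.
move=> iY YS gb; elim: q Z => [|q IHq] Z fZ; have iZ := fcol_ideal fZ; have iYq := iY.
  rewrite addn0 => /(colen_inj fZ (ideal_addP (iY 0%N) iZ) (sub_addr (iY 0%N))) ZE.
  exists 0%N => t _ x Yx; apply: sub_addr; first exact: ideal_scaleP.
  by rewrite ZE; exact: sub_addl.
move=> leZ; apply: contrapT => /not_ev infT.
have [ts [tsT Jts]] := generating_infinite gb infT.
have iYq1 := iY q; have iYq2 := iY q.+1.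
have bY t : b t *> Y q `<=` Y q.+1 by rewrite YS; apply: ideal_scale_mul; exact: gb.1.
have lt t : t \in ts -> (colen (Y q.+1 <+> Z) < colen (b t *> Y q <+> Z))%N.
  move=> /tsT bad; rewrite ltnNge; apply/negP => le; apply: bad.
  have fbZ : fcol (b t *> Y q <+> Z) by apply: fcol_sub fZ _ _ => //; exact: sub_addr.
  rewrite (colen_inj fbZ _ _ le) //; [exact: sub_addl | exact: ideal_addS].
have fZb t : fcol (Z :% b t) by apply: fcol_sub fZ _ _ => //; exact: sub_colon.
have /ev_seq[N NP] : forall t, t \in ts -> ev (fun u => Y q `<=` b u *> Y q.-1 <+> Z :% b t).
  move=> t tts; apply: IHq => //.
  by have := colen_scale_add (b t) fZ iYq1; have := lt t tts; move: leZ; do 5! move: (colen _); lia.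
have [t [/NP tN]] := infT N; apply; rewrite YS.
apply: generating_mul_sub Jts _ => // u uts.
apply: subset_trans (ideal_scaleS (tN u uts)) _.
move=> _ [_ [_ [y Yy <-] [z Zz <-]] <-]; rewrite mulrDr mulrCA.
exists (b t * (b u * y)); last by exists (b u * z).
exists (b u * y) => //; case: (q) Yy => [|q'] Yy; first exact: idlMl.
by rewrite YS; apply: mem_ideal_mul => //; exact: gb.1.
Qed.

Local Notation X I J p q := (I ^^ p <**> J ^^ q).

(** Induction on [p]. If a t I^p J^q + Z exceeds I^(p+1) J^q + Z in colength by at most q for all
    large t, the version for one ideal applies modulo a t I^p J^q + Z. Otherwise infinitely many t
    lose at least q + 1, so the relative length of Z : a t drops below (p + 1)(q + 1), and the
    induction hypothesis holds for these colons. *)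
Lemma eakin_sathaye2 I J a b p q Z : generating I a -> generating J b -> fcol Z ->
  (colen Z < colen (X I J p q <+> Z) + p.+1 * q.+1)%N ->
  ev (fun t => ev (fun u =>
    X I J p q `<=` a t *> X I J p.-1 q <+> b u *> X I J p q.-1 <+> Z)).
Proof.
move=> ga gb; have es1 k Z' : fcol Z' -> (colen Z' <= colen (X I J k q <+> Z') + q)%N ->
    ev (fun u => X I J k q `<=` b u *> X I J k q.-1 <+> Z').
  by apply: (eakin_sathaye1 (Y := fun i => X I J k i) (J := J)) => // i; rewrite ideal_mulCA.
elim: p Z => [|p IHp] Z fZ leZ; have iZ := fcol_ideal fZ.
  exists 0%N => t _; move: leZ; rewrite mul1n addnS ltnS => /(es1 _ _ fZ).
  apply: ev_mono => u; move/subset_trans; apply.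
  by rewrite -ideal_addA; apply: sub_addr.
have [[N NP]|] := pselect (ev (fun t =>
    (colen (a t *> X I J p q <+> Z) <= colen (X I J p.+1 q <+> Z) + q)%N)).
  exists N => t /NP le.
  have faZ : fcol (a t *> X I J p q <+> Z) by apply: fcol_sub fZ _ _ => //; exact: sub_addr.
  have aX : a t *> X I J p q `<=` X I J p.+1 q.
    by rewrite ideal_powS -ideal_mulA; apply: ideal_scale_mul; exact: ga.1.
  have : (colen (a t *> X I J p q <+> Z) <=
          colen (X I J p.+1 q <+> (a t *> X I J p q <+> Z)) + q)%N.
    by rewrite ideal_addA [X I J p.+1 q <+> a t *> _]ideal_add_idr.
  move=> /(es1 _ _ faZ); apply: ev_mono => u; rewrite ideal_addA.
  by rewrite [b u *> _ <+> _]ideal_addC.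
move=> /not_ev infT; have [ts [tsT Its]] := generating_infinite ga infT.
have fZa t : fcol (Z :% a t) by apply: fcol_sub fZ _ _ => //; exact: sub_colon.
have iX : is_ideal (X I J p q) by [].
have IHts t : t \in ts -> ev (fun v => ev (fun u =>
    X I J p q `<=` a v *> X I J p.-1 q <+> b u *> X I J p q.-1 <+> Z :% a t)).
  move=> /tsT lt; apply: IHp => //.
  by have := colen_scale_add (a t) fZ iX; move: leZ lt; do 5! move: (colen _); lia.
have := ev_seq IHts; apply: ev_mono => v /ev_seq; apply: ev_mono => u tsP.
rewrite [I ^^ p.+1]ideal_powS -ideal_mulA.
apply: generating_mul_sub Its _ => // t /tsP/(@ideal_scaleS _ (a t))/subset_trans; apply.
move=> _ [_ [_ [_ [x Xx <-] [_ [y Xy <-] <-]] [z Zz <-]] <-].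
exists (a v * (a t * x) + b u * (a t * y)); last by exists (a t * z) => //; ring.
exists (a v * (a t * x)).
  (* For p = 0 the truncated predecessor is 0 again, and multiplication by [a t] merely stays inside
     the ideal. *)
  exists (a t * x) => //; case: (p) Xx => [|p'] Xx; first exact: (@idlMl _ (X I J 0 q)).
  by rewrite ideal_powS -ideal_mulA; apply: mem_ideal_mul => //; exact: ga.1.
exists (b u * (a t * y)) => //; exists (a t * y) => //.
by rewrite /= -ideal_mulA; apply: mem_ideal_mul => //; exact: ga.1.
Qed.

(** Multiplication by I^i J^j carries one inclusion to all larger exponents. *)
Lemma joint_reduction_of_sub I J x y n : I x -> J y ->
  X I J n.+1 n.+1 `<=` x *> X I J n n.+1 <+> y *> X I J n.+1 n ->
  is_joint_reduction I J x y.
Proof.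
move=> Ix Jy H; split=> //; exists n => r s nr ns.
apply/seteqP; split; last first.
  apply: ideal_add_sub => //; first by rewrite [I ^^ r.+1]ideal_powS -ideal_mulA;
    exact: ideal_scale_mul.
  by rewrite [J ^^ s.+1]ideal_powS ideal_mulCA; exact: ideal_scale_mul.
rewrite -(subnK nr) -(subnK ns) -!addnS.
move: (r - n)%N (s - n)%N => i j.
have XD p q : X I J (i + p)%N (j + q)%N = X I J i j <**> X I J p q.
  by rewrite !ideal_powD ideal_mulACA.
rewrite !XD; apply: subset_trans (ideal_mulS (@subset_refl _ _) H) _.
by rewrite ideal_mulDr // !ideal_mul_scale.
Qed.

Hypothesis parR : exists x y,
  [/\ m x, m y, regular_pair x y & fcol (x *> [set: R] <+> y *> [set: R])].

(** The difference of the two colengths is the number of generators of Q = I^n J^n. With w a power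
    of x in IJ, the ideal mQ + w^n R contains w^n R + y Q, of colength n c + colen Q where c = colen
    (w, y), and mQ : w^n contains m. *)
Lemma colen_local_mul I J : fcol I -> fcol J ->
  exists c, forall n, (colen (m <**> X I J n n) <= colen (X I J n n) + n * c + 1)%N.
Proof.
move=> fI fJ; have [x [y [mx my xy fxy]]] := parR; have im := local_ideal localR.
have fIJ := fcol_mul noethR fI fJ.
have [k xk] := fcol_has_pow noethR localR fIJ mx.
pose w := x ^+ k; have fwy : fcol (w *> [set: R] <+> y *> [set: R]) := fcol_pair_pow k 1 fxy.
exists (colen (w *> [set: R] <+> y *> [set: R])) => n; set Q := X I J n n.
have fQ : fcol Q by apply: fcol_mul => //; exact: fcol_pow.
have iQ := fcol_ideal fQ.
have Qw : Q (w ^+ n) by rewrite /Q -ideal_mul_pow; exact: mem_ideal_pow.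
have fwny : fcol (w ^+ n *> [set: R] <+> y *> [set: R]) := fcol_pair_pow n 1 fwy.
have kw := fcol_koszul noethR localR parR fwny.
have := colen_koszul kw fwny (@fcolT R) fQ.
rewrite (@ideal_eqT _ (_ `&` _)) ?colenT //; last by split=> //=; rewrite mulr1.
have := colen_pair_pow noethR localR parR n 1 fwy; rewrite expr1 muln1 => ->.
rewrite !addn0 => E.
have fwQ : fcol (w ^+ n *> [set: R] <+> y *> Q) := fcol_koszul_add fwny (@fcolT R) fQ.
have fmQ : fcol (m <**> Q) by apply: fcol_mul => //; exact: fcol_local.
have le1 : (colen (m <**> Q <+> w ^+ n *> [set: R]) <= colen (w ^+ n *> [set: R] <+> y *> Q))%N.
  apply: colen_le => //; rewrite ideal_addC; apply: ideal_addS => //; exact: ideal_scale_mul.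
have le2 : (colen ((m <**> Q) :% w ^+ n) <= 1)%N.
  apply: leq_trans (colen_local localR); apply: colen_le => //; first exact: fcol_local.
  by move=> z mz /=; rewrite mulrC; exact: mem_ideal_mul.
rewrite (colen_colon (w ^+ n) fmQ); move: E le1 le2; do 5! move: (colen _); lia.
Qed.

Lemma generic_joint_reduction I J a b : fcol I -> fcol J ->
  generating I a -> generating J b ->
  ev (fun t => ev (fun u => is_joint_reduction I J (a t) (b u))).
Proof.
move=> fI fJ ga gb; have [c cP] := colen_local_mul fI fJ.
have im := local_ideal localR.
(* With this n the square (n + 1)^2 exceeds the linear bound n c + 1. The inclusion is then obtained
   modulo m I^n J^n, which Nakayama's lemma removes. *)
set n := c.+1; have fQ : fcol (X I J n n) by apply: fcol_mul => //; exact: fcol_pow.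
have fmQ : fcol (m <**> X I J n n) by apply: fcol_mul => //; exact: fcol_local.
have /(eakin_sathaye2 ga gb fmQ) :
    (colen (m <**> X I J n n) < colen (X I J n n <+> m <**> X I J n n) + n.+1 * n.+1)%N.
  rewrite ideal_add_idr //; last exact: ideal_mul_subr.
  apply: leq_ltn_trans (cP n) _; rewrite /n; nia.
apply: ev_mono => t; apply: ev_mono => u /(nakayama noethR localR) H.
apply: (@joint_reduction_of_sub _ _ _ _ c); [exact: ga.1 | exact: gb.1 |].
exact: H.
Qed.

End GenericElements.

(** * Hilbert polynomials *)

Section NumericalFunctions.
Implicit Types (f : nat -> int) (c : int) (N n r s : nat).

Lemma bin2S n : 'C(n.+2, 2) = ('C(n.+1, 2) + n.+1)%N.
Proof. by rewrite binS bin1. Qed.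

Lemma quadratic_of_second_difference f c N :
  (forall n, (N <= n)%N -> f n.+2 + f n = f n.+1 + f n.+1 + c) ->
  exists e1 e2, forall n, (N <= n)%N -> f n = c * 'C(n.+1, 2)%:Z - e1 * n%:Z + e2.
Proof.
move=> fN; pose e1 := c * N.+1%:Z - (f N.+1 - f N).
exists e1, (f N - c * 'C(N.+1, 2)%:Z + e1 * N%:Z) => n /subnK <-.
have dE k : f (k + N).+1 - f (k + N)%N = c * (k + N).+1%:Z - e1.
  elim: k => [|k IHk]; first by rewrite /e1 add0n; ring.
  have := fN (k + N)%N (leq_addl _ _); rewrite addSn.
  have -> : (k + N).+2%:Z = (k + N).+1%:Z + 1 by lia.
  by rewrite mulrDr mulr1; move: IHk; move: (c * _); lia.
elim: (n - N)%N => [|k IHk]; first by rewrite add0n; ring.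
have := dE k; rewrite addSn bin2S PoszD mulrDr.
have -> : (k + N).+1%:Z = (k + N)%:Z + 1 by lia.
by rewrite !mulrDr !mulr1; move: IHk; move: (c * _) (c * _) (e1 * _); lia.
Qed.

Lemma mixed_difference_const (L : nat -> nat -> int) c N :
  (forall r s, (N <= r)%N -> (N <= s)%N -> L r.+1 s.+1 + L r s = L r.+1 s + L r s.+1 + c) ->
  forall i j, L (N + i)%N (N + j)%N = L (N + i)%N N + L N (N + j)%N - L N N + c * (i * j)%N%:Z.
Proof.
move=> LN; elim=> [|i IHi] j; first by rewrite addn0 mul0n; lia.
elim: j => [|j IHj]; first by rewrite addn0 muln0; lia.
have := LN (N + i)%N (N + j)%N (leq_addr _ _) (leq_addr _ _).
have := IHi j; have := IHi j.+1; move: IHj; rewrite !addnS.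
have -> : (i.+1 * j.+1)%N%:Z = (i * j)%N%:Z + i%:Z + j%:Z + 1 by lia.
have -> : (i * j.+1)%N%:Z = (i * j)%N%:Z + i%:Z by lia.
have -> : (i.+1 * j)%N%:Z = (i * j)%N%:Z + j%:Z by lia.
by rewrite !mulrDr; lia.
Qed.

(** [g i j] is the accumulated excess of the mixed difference over [c] on a rectangle with corner
    (N, N). It grows in both variables and is bounded by [L N N], hence is eventually constant, and
    there the excess is zero. *)
Lemma mixed_difference_eventually (L : nat -> nat -> nat) (c : nat) N :
  (forall r s, (N <= r)%N -> (N <= s)%N ->
     (c + L r.+1 s + L r s.+1 <= L r.+1 s.+1 + L r s)%N) ->
  (forall p q r s, (L (p + r)%N (q + s)%N <= r * s * c + L p (q + s)%N + L (p + r)%N q)%N) ->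
  exists N', forall r s, (N' <= r)%N -> (N' <= s)%N ->
     (c + L r.+1 s + L r s.+1 = L r.+1 s.+1 + L r s)%N.
Proof.
move=> LN Lub.
pose g i j : int := (L (N + i)%N (N + j)%N)%:Z + (L N N)%:Z - (L N (N + j)%N)%:Z - (L (N
  + i)%N N)%:Z
  - (i * j * c)%N%:Z.
have gE i j : g i.+1 j.+1 + g i j = g i.+1 j + g i j.+1 +
    ((L (N + i)%N.+1 (N + j)%N.+1)%:Z + (L (N + i)%N (N + j)%N)%:Z
     - (L (N + i)%N.+1 (N + j)%N)%:Z - (L (N + i)%N (N + j)%N.+1)%:Z - c%:Z).
  rewrite /g !addnS.
  have -> : (i.+1 * j.+1 * c)%N%:Z = (i * j * c)%N%:Z + (i * c)%N%:Z + (j * c)%N%:Z + c%:Z by lia.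
  have -> : (i.+1 * j * c)%N%:Z = (i * j * c)%N%:Z + (j * c)%N%:Z by lia.
  have -> : (i * j.+1 * c)%N%:Z = (i * j * c)%N%:Z + (i * c)%N%:Z by lia.
  by lia.
have gS i j : g i.+1 j + g i j.+1 <= g i.+1 j.+1 + g i j.
  by rewrite gE; have := LN (N + i)%N (N + j)%N (leq_addr _ _) (leq_addr _ _); lia.
have g0r i : g i 0%N = 0 by rewrite /g addn0 muln0 mul0n; lia.
have g0l j : g 0%N j = 0 by rewrite /g addn0 !mul0n; lia.
have gr i j : g i j <= g i.+1 j.
  by elim: j => [|j IHj]; [rewrite !g0r | have := gS i j; lia].
have gs i j : g i j <= g i j.+1.
  by elim: i => [|i IHi]; [rewrite !g0l | have := gS i j; lia].
have ge0 i j : 0 <= g i j by elim: i => [|i IHi]; [rewrite g0l | have := gr i j; lia].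
have gub i j : g i j <= (L N N)%:Z by have := Lub N N i j; rewrite /g; lia.
have gmono i j k l : g i j <= g (i + k)%N (j + l)%N.
  elim: k => [|k IHk]; last by rewrite addnS; have := gr (i + k)%N (j + l)%N; lia.
  elim: l => [|l IHl]; first by rewrite !addn0.
  by rewrite addn0 !addnS in IHl *; have := gs i (j + l)%N; lia.
pose P v := `[< exists i j, g i j = v%:Z >].
have exP : exists v, P v by exists 0%N; apply/asboolP; exists 0%N, 0%N.
have ubP v : P v -> (v <= L N N)%N by move/asboolP => [i [j ijE]]; have := gub i j; lia.
have [v /asboolP[i0 [j0 vE]] vmax] := ex_maxnP exP ubP.
have gmax i j : (i0 <= i)%N -> (j0 <= j)%N -> g i j = v%:Z.
  move=> /subnKC<- /subnKC<-; have := gmono i0 j0 (i - i0)%N (j - j0)%N.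
  set i' := (_ + _)%N; set j' := (_ + _)%N.
  have [w wE] : exists w : nat, g i' j' = w%:Z by exists `|g i' j'|%N; have := ge0 i' j'; lia.
  have : P w by apply/asboolP; exists i', j'.
  by move=> /vmax; lia.
exists (N + maxn i0 j0)%N => r s Nr Ns.
have := gE (r - N)%N (s - N)%N; rewrite !gmax; [|lia..].
by rewrite !subnKC; [lia|lia|lia].
Qed.

Lemma quadratic_ge0 (c e1 e2 : int) N :
  (forall n, (N <= n)%N -> 0 <= c * 'C(n.+1, 2)%:Z + e1 * n%:Z + e2) -> 0 <= c.
Proof.
move=> cN; case: (boolP (0 <= c)) => // c0; exfalso.
(* If c <= -1, the value at n is negative as soon as n + 1 > 2 (|e1| + |e2|) and n >= 1. *)
pose n := (N + 2 * (`|e1| + `|e2|) + 2)%N.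
have := cN n (leq_trans (leq_addr _ _) (leq_addr _ _)).
have [k kE] : exists k : nat, (n = k + 2 * (`|e1| + `|e2|) + 2)%N by exists N.
have binE : (2 * 'C(n.+1, 2) = n.+1 * n)%N by rewrite -mul_bin_diag bin1.
rewrite kE in binE *; clear -c0 binE; move: ('C(_, _)) binE; nia.
Qed.

Lemma affine_ge0 c (e : int) N :
  (forall n, (N <= n)%N -> 0 <= c * n%:Z + e) -> 0 <= c.
Proof.
move=> cN; case: (boolP (0 <= c)) => // c0; exfalso.
have := cN (N + `|e| + 1)%N; nia.
Qed.

Lemma affine_eq0 c (e : int) N :
  (forall n, (N <= n)%N -> c * n%:Z + e = 0) -> c = 0 /\ e = 0.
Proof.
move=> cN; have := cN N (leqnn _); have := cN N.+1 (leqnSn _).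
rewrite -addn1 PoszD mulrDr mulr1; nia.
Qed.

End NumericalFunctions.

Section HilbertPolynomials.
Variables (R : comNzRingType) (m : set R).
Hypotheses (noethR : is_noetherian R) (localR : is_local m).
Hypothesis resR : infinite_residue_field m.
Hypothesis parR : exists x y,
  [/\ m x, m y, regular_pair x y & fcol (x *> [set: R] <+> y *> [set: R])].
Implicit Types (A B C I J K M P Q X Y Z : set R) (a b c x y z : R).

Local Notation X I J p q := (I ^^ p <**> J ^^ q).
Local Notation L I J p q := (colen (X I J p q)).

Lemma fcol_mul_pow I J p q : fcol I -> fcol J -> fcol (X I J p q).
Proof. by move=> fI fJ; apply: fcol_mul => //; exact: fcol_pow. Qed.

Lemma ideal_mul_pow0 I J p : X I J p 0 = I ^^ p.
Proof. by rewrite ideal_mulT. Qed.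

Lemma ideal_pow0_mul I J q : X I J 0 q = J ^^ q.
Proof. by rewrite ideal_Tmul. Qed.

Lemma joint_reduction_exists I J : fcol I -> fcol J ->
  exists a b, is_joint_reduction I J a b.
Proof.
move=> fI fJ; have [a ga] := generating_exists noethR localR resR (fcol_ideal fI).
have [b gb] := generating_exists noethR localR resR (fcol_ideal fJ).
have [N NP] := generic_joint_reduction noethR localR parR fI fJ ga gb.
by have [N' N'P] := NP N (leqnn _); exists (a N), (b N'); exact: N'P.
Qed.

Section JointReduction.
Variables (I J : set R) (a b : R).
Hypotheses (fI : fcol I) (fJ : fcol J) (jrab : is_joint_reduction I J a b).

Local Notation e := (colen (a *> [set: R] <+> b *> [set: R])).

Lemma joint_reduction_fcol : fcol (a *> [set: R] <+> b *> [set: R]).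
Proof.
have [_ _ [N /(_ N N (leqnn _) (leqnn _)) E]] := jrab.
apply: fcol_sub (fcol_mul_pow N.+1 N.+1 fI fJ) _ _ => //; rewrite E.
by apply: ideal_addS; exact: ideal_scaleS.
Qed.

Let fab := joint_reduction_fcol.

Lemma joint_reduction_koszul r s : koszul (a ^+ r) (b ^+ s).
Proof. exact: (fcol_koszul noethR localR parR (fcol_pair_pow r s fab)). Qed.

Lemma joint_reduction_pow_sub p q r s :
  a ^+ r *> X I J p (q + s) <+> b ^+ s *> X I J (p + r) q `<=` X I J (p + r) (q + s).
Proof.
have [Ia Jb _] := jrab; apply: ideal_add_sub => //.
  rewrite [(p + r)%N]addnC [I ^^ (r + p)]ideal_powD -ideal_mulA.
  by apply: ideal_scale_mul; exact: mem_ideal_pow.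
rewrite [(q + s)%N]addnC [J ^^ (s + q)]ideal_powD ideal_mulCA.
by apply: ideal_scale_mul; exact: mem_ideal_pow.
Qed.

Lemma colen_joint_reduction_pow p q r s :
  (colen (a ^+ r *> X I J p (q + s) <+> b ^+ s *> X I J (p + r) q) +
   colen ((X I J p (q + s) :% (b ^+ s)) `&` (X I J (p + r) q :% (a ^+ r))) =
   r * s * e + L I J p (q + s) + L I J (p + r) q)%N.
Proof.
rewrite -(colen_pair_pow noethR localR parR) //.
by apply: colen_koszul; [exact: joint_reduction_koszul | exact: fcol_pair_pow | exact:
  fcol_mul_pow..].
Qed.

Lemma joint_reduction_pow_le p q r s :
  (L I J (p + r) (q + s) <= r * s * e + L I J p (q + s) + L I J (p + r) q)%N.
Proof.
rewrite -colen_joint_reduction_pow; apply: leq_trans (leq_addr _ _).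
apply: colen_le => //; last exact: joint_reduction_pow_sub.
by apply: fcol_koszul_add; [exact: fcol_pair_pow | exact: fcol_mul_pow..].
Qed.

Lemma sub_joint_reduction_colon r s :
  X I J r s `<=` (X I J r s.+1 :% b) `&` (X I J r.+1 s :% a).
Proof.
have [Ia Jb _] := jrab; move=> x Xx; split=> /=.
  by rewrite ideal_mulCA; exact: mem_ideal_mul.
by rewrite -ideal_mulA; exact: mem_ideal_mul.
Qed.

(* The mixed second difference of [L I J] is at least [e] far out, while its sums over
   rectangles exceed the sums of [e] by a bounded amount only. *)
Lemma joint_reduction_difference : exists N, forall r s, (N <= r)%N -> (N <= s)%N ->
  (e + L I J r.+1 s + L I J r s.+1 = L I J r.+1 s.+1 + L I J r s)%N /\
  (X I J r s.+1 :% b) `&` (X I J r.+1 s :% a) = X I J r s.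
Proof.
have [_ _ [N NP]] := jrab.
have E r s : (N <= r)%N -> (N <= s)%N ->
    (L I J r.+1 s.+1 + colen ((X I J r s.+1 :% b) `&` (X I J r.+1 s :% a)) =
     e + L I J r s.+1 + L I J r.+1 s)%N.
  move=> Nr Ns; have := colen_joint_reduction_pow r s 1 1.
  by rewrite !expr1 !addn1 !mul1n -NP.
have fL p q := fcol_mul_pow p q fI fJ.
have le r s : (colen ((X I J r s.+1 :% b) `&` (X I J r.+1 s :% a)) <= L I J r s)%N.
  by apply: colen_le => //; exact: sub_joint_reduction_colon.
have [||N' N'P] := @mixed_difference_eventually (fun r s => L I J r s) e N.
- by move=> r s Nr Ns; have := E r s Nr Ns; have := le r s; do 6! move: (colen _); lia.
- exact: joint_reduction_pow_le.
exists (maxn N N') => r s; rewrite !geq_max => /andP[Nr N'r] /andP[Ns N's].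
have E' := N'P r s N'r N's; split=> //; apply/esym/colen_inj => //.
- exact: sub_joint_reduction_colon.
- by move: E' (E r s Nr Ns); do 6! move: (colen _); lia.
Qed.

End JointReduction.

(** For I = J = K the mixed difference at (N, n - N) is the ordinary second difference at n. *)
Lemma colen_pow_quadratic K a c : fcol K -> is_joint_reduction K K a c ->
  ev (fun n => ((colen (K ^^ n.+2))%:Z + (colen (K ^^ n))%:Z =
    (colen (K ^^ n.+1))%:Z + (colen (K ^^ n.+1))%:Z +
    (colen (a *> [set: R] <+> c *> [set: R]))%:Z)%R).
Proof.
move=> fK jr; have [N NP] := joint_reduction_difference fK fK jr.
exists (N + N)%N => n Nn; have Nn' : (N <= n - N)%N by lia.
have := (NP N (n - N)%N (leqnn _) Nn').1; rewrite -!ideal_powD !addSn !addnS subnKC; last by lia.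
by do 4! move: (colen _); lia.
Qed.

Lemma hilbert_coefP K : fcol K -> ev (fun n => (colen (K ^^ n))%:Z =
  hilbert_coef K 0%N * 'C(n.+1, 2)%:Z - hilbert_coef K 1%N * n%:Z + hilbert_coef K 2%N).
Proof.
move=> fK; rewrite /hilbert_coef; case: xgetP => [h _ [N NP]|nh].
  exists N => n /NP[l ll <-]; congr (_%:Z).
  by apply/esym/has_colength_colen => //; exact: fcol_pow.
have [a [c jr]] := joint_reduction_exists fK fK.
have [N /quadratic_of_second_difference[e1 [e2 E]]] := colen_pow_quadratic fK jr.
case: (nh (fun i => match i with
  0 => (colen (a *> [set: R] <+> c *> [set: R]))%:Z | 1 => e1 | _ => e2 end)%N).
exists N => n Nn; exists (colen (K ^^ n)); last exact: E.
by apply/has_colength_colen => //; exact: fcol_pow.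
Qed.

Lemma hilbert_coef0 K a c : fcol K -> is_joint_reduction K K a c ->
  hilbert_coef K 0%N = (colen (a *> [set: R] <+> c *> [set: R]))%:Z.
Proof.
move=> fK jr; have [N NP] := hilbert_coefP fK; have [N' N'P] := colen_pow_quadratic fK jr.
set n := maxn N N'; have := N'P n (leq_maxr _ _).
have Nn : (N <= n)%N := leq_maxl _ _.
rewrite !NP ?(leqW, Nn) // !bin2S !PoszD !mulrDr.
have -> : n.+2%:Z = n%:Z + 2 by lia.
have -> : n.+1%:Z = n%:Z + 1 by lia.
rewrite !mulrDr; lia.
Qed.

Lemma bihilbert_sumE (e : nat -> nat -> int) r s :
  \sum_(i < 3) \sum_(j < 3 | (i + j <= 2)%N)
     (-1) ^+ (i + j) * e i j * 'C((r + i).-1, i)%:Z * 'C((s + j).-1, j)%:Z =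
  e 2%N 0%N * 'C(r.+1, 2)%:Z + e 1%N 1%N * (r * s)%N%:Z + e 0%N 2%N * 'C(s.+1, 2)%:Z
  - e 1%N 0%N * r%:Z - e 0%N 1%N * s%:Z + e 0%N 0%N.
Proof.
under eq_bigr => i _ do rewrite big_mkcond !big_ord_recl big_ord0.
rewrite !big_ord_recl big_ord0 /= /bump /=.
rewrite !addn0 !addn1 !addn2 /= !bin0 !bin1 PoszM; ring.
Qed.

(** The mixed difference is eventually constant; the pure second differences remain. Since I^r
    (IJ)^s = I^(r+s) J^s, subtracting the mixed difference of (I, J) from that of (I, IJ) leaves the
    second difference in r. The pair (IJ, J) does the same for s. *)
Lemma bihilbert_coefP I J : fcol I -> fcol J ->
  exists N, forall r s, (N <= r)%N -> (N <= s)%N -> (L I J r s)%:Z =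
    bihilbert_coef I J 2%N 0%N * 'C(r.+1, 2)%:Z + bihilbert_coef I J 1%N 1%N * (r * s)%N%:Z
    + bihilbert_coef I J 0%N 2%N * 'C(s.+1, 2)%:Z - bihilbert_coef I J 1%N 0%N * r%:Z
    - bihilbert_coef I J 0%N 1%N * s%:Z + bihilbert_coef I J 0%N 0%N.
Proof.
move=> fI fJ; rewrite /bihilbert_coef; case: xgetP => [h _ [N NP]|nh].
  exists N => r s Nr Ns; have [l ll] := NP r s Nr Ns; rewrite bihilbert_sumE => <-.
  by congr (_%:Z); apply/esym/has_colength_colen => //; exact: fcol_mul_pow.
exfalso.
have fIJ : fcol (I <**> J) by exact: fcol_mul.
have [a [b /(joint_reduction_difference fI fJ)[N NP]]] := joint_reduction_exists fI fJ.
have [a' [b' /(joint_reduction_difference fI fIJ)[N1 N1P]]] := joint_reduction_exists fI fIJ.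
have [a'' [b'' /(joint_reduction_difference fIJ fJ)[N2 N2P]]] := joint_reduction_exists fIJ fJ.
move: NP N1P N2P; move: (colen _) (colen _) (colen _) => e'' e' e NP N1P N2P.
have [M [MN MN1 MN2]] : exists M : nat, [/\ N <= M, N1 <= M & N2 <= M]%N.
  by exists (N + N1 + N2)%N; split; lia.
pose f r s : int := (L I J r s)%:Z.
have XI r s : X I (I <**> J) r s = X I J (r + s) s.
  by rewrite ideal_mul_pow ideal_mulA -ideal_powD.
have XJ r s : X (I <**> J) J r s = X I J r (r + s).
  by rewrite ideal_mul_pow -ideal_mulA -ideal_powD.
have dI n : (M + M <= n)%N -> f n.+2 M + f n M = f n.+1 M + f n.+1 M + (e'%:Z - e%:Z).
  move=> Mn; have [||E _] := N1P (n - M)%N M; try lia.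
  have [||E' _] := NP n.+1 M; try lia.
  move: E E'; rewrite !XI !addSn !addnS !subnK /f; [|lia..].
  by do 5! move: (colen _); lia.
have dJ n : (M + M <= n)%N -> f M n.+2 + f M n = f M n.+1 + f M n.+1 + (e''%:Z - e%:Z).
  move=> Mn; have [||E _] := N2P M (n - M)%N; try lia.
  have [||E' _] := NP M n.+1; try lia.
  move: E E'; rewrite !XJ !addSn !addnS !subnKC /f; [|lia..].
  by do 5! move: (colen _); lia.
have [e10 [c1 fI']] := quadratic_of_second_difference dI.
have [e01 [c2 fJ']] := quadratic_of_second_difference dJ.
have fIJE := @mixed_difference_const f e%:Z M _.
(* These constants come from expanding L(r,M) + L(M,s) - L(M,M) + e (r - M)(s - M). *)
pose e0 (i j : nat) : int := match i, j with
  | 2%N, 0%N => e'%:Z - e%:Z | 1%N, 1%N => e%:Z | 0%N, 2%N => e''%:Z - e%:Z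
  | 1%N, 0%N => e10 + e%:Z * M%:Z | 0%N, 1%N => e01 + e%:Z * M%:Z
  | _, _ => c1 + c2 - f M M + e%:Z * M%:Z * M%:Z end.
apply: (nh e0).
exists (M + M)%N => r s Mr Ms; exists (L I J r s).
  by apply/has_colength_colen => //; exact: fcol_mul_pow.
rewrite bihilbert_sumE -/(f r s) /e0 {e0}.
have [rE sE] : (M + (r - M) = r)%N /\ (M + (s - M) = s)%N by rewrite !subnKC; lia.
rewrite -[in LHS]rE -[in LHS]sE fIJE; last first.
  by move=> i j Mi Mj; have [||E _] := NP i j; rewrite /f; lia.
rewrite rE sE fI' // fJ' //.
have -> : ((r - M) * (s - M))%N%:Z = (r%:Z - M%:Z) * (s%:Z - M%:Z) by rewrite PoszM -!subzn //; lia.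
rewrite PoszM; ring.
Qed.

Lemma bihilbert_coef11 I J a b : fcol I -> fcol J -> is_joint_reduction I J a b ->
  bihilbert_coef I J 1%N 1%N = (colen (a *> [set: R] <+> b *> [set: R]))%:Z.
Proof.
move=> fI fJ jr; have [N NP] := bihilbert_coefP fI fJ.
have [N' N'P] := joint_reduction_difference fI fJ jr.
set n := maxn N N'; have [] := N'P n n (leq_maxr _ _) (leq_maxr _ _).
have Nn : (N <= n)%N := leq_maxl _ _.
have := NP n n Nn Nn; have := NP n.+1 n (leqW Nn) Nn; have := NP n n.+1 Nn (leqW Nn).
have := NP n.+1 n.+1 (leqW Nn) (leqW Nn).
have -> : (n.+1 * n.+1)%N%:Z = (n * n)%N%:Z + n%:Z + n%:Z + 1 by lia.
have -> : (n.+1 * n)%N%:Z = (n * n)%N%:Z + n%:Z by lia.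
have -> : (n * n.+1)%N%:Z = (n * n)%N%:Z + n%:Z by lia.
have -> : n.+1%:Z = n%:Z + 1 by lia.
rewrite !mulrDr => + + + + + _.
do 5! move: (colen _); lia.
Qed.

End HilbertPolynomials.

(** * Superficial elements *)

Section Superficial.
Variables (R : comNzRingType) (m : set R).
Hypotheses (noethR : is_noetherian R) (localR : is_local m).
Hypothesis resR : infinite_residue_field m.
Hypothesis parR : exists x y,
  [/\ m x, m y, regular_pair x y & fcol (x *> [set: R] <+> y *> [set: R])].
Variables (K : set R) (a : nat -> R).
Hypotheses (fK : fcol K) (gKa : generating K a).
Implicit Types (x y z c : R) (V : nat -> set R).

Definition superficial (I : set R) x := ev (fun n => I ^^ n.+1 :% x = I ^^ n).

Let fKn n : fcol (K ^^ n). Proof. exact: fcol_pow. Qed.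

Lemma joint_reduction_colon_pow x c : is_joint_reduction K K x c ->
  ev (fun n => forall z, (K ^^ n.+1) (x * z) -> (K ^^ n.+1) (c * z) -> (K ^^ n) z).
Proof.
move=> jr; have [N NP] := joint_reduction_difference noethR localR parR fK fK jr.
exists (N + N)%N => n Nn z xz cz; have Nn' : (N <= n - N)%N by lia.
have := (NP N (n - N)%N (leqnn _) Nn').2.
rewrite -!ideal_powD addSn addnS subnKC; last by lia.
by move=> <-.
Qed.

(** [eps] is the length of (K^(n+1) : x) / K^n, zero exactly when x is superficial. It stabilizes
    because the colength of K^n + xR eventually grows by e = colen (x, c) at each step, and e is
    also the second difference of the colength of K^n. *)
Lemma colen_colon_pow_const x c : is_joint_reduction K K x c ->
  exists eps, ev (fun n => (colen (K ^^ n) = colen (K ^^ n.+1 :% x) + eps)%N).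
Proof.
move=> jr; have [Kx Kc [N0 N0P]] := jr.
have fxc := joint_reduction_fcol noethR fK fK jr.
have [N1 N1P] := colen_pow_quadratic noethR localR parR fK jr.
pose e := colen (x *> [set: R] <+> c *> [set: R]).
pose g n := colen (K ^^ n <+> x *> [set: R]).
have gS n : (N0 + N0 < n)%N -> g n.+1 = (e + g n)%N.
  move=> Nn; have KE : K ^^ n.+1 = x *> K ^^ n <+> c *> K ^^ n.
    have [s [Ns ->]] : exists s : nat, (N0 <= s)%N /\ n = (N0 + s).+1.
      by exists (n - N0.+1)%N; split; lia.
    by have := N0P N0 s (leqnn _) Ns; rewrite -!ideal_powD !addnS !addSn.
  pose B := K ^^ n <+> x *> [set: R].
  have fB : fcol B by apply: fcol_sub (fKn n) _ _ => //; exact: sub_addl.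
  have := colen_koszul (fcol_koszul noethR localR parR fxc) fxc (@fcolT R) fB.
  rewrite (@ideal_eqT _ (_ `&` _)) ?colenT //; last first.
    by split=> //=; rewrite mulr1; apply: sub_addr => //; exact: ideal_scaleT.
  suff -> : x *> [set: R] <+> c *> B = K ^^ n.+1 <+> x *> [set: R].
    by rewrite !addn0.
  apply/seteqP; split.
    apply: ideal_add_sub => //; first exact: sub_addr.
    move=> _ [_ [k Kk [_ [r _ <-] <-]] <-]; rewrite mulrDr; exists (c * k).
      exact: mem_ideal_mul.
    by exists (c * (x * r)) => //; exists (c * r) => //; ring.
  rewrite KE; apply: ideal_add_sub => //; last exact: sub_addl.
  apply: ideal_addS; [exact: ideal_scaleS | apply/ideal_scaleS/sub_addl => //].
have fE n : colen (K ^^ n.+1) = (g n.+1 + colen (K ^^ n.+1 :% x))%N by exact: colen_colon.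
have le n : (colen (K ^^ n.+1 :% x) <= colen (K ^^ n))%N.
  by apply: colen_le => // z Kz; exact: mem_ideal_mul.
pose M := (N0 + N0 + N1).+1.
exists (colen (K ^^ M) - colen (K ^^ M.+1 :% x))%N; exists M => n /subnK <-.
elim: (n - M)%N => [|k IHk]; first by rewrite add0n subnKC.
have E2 := N1P (k + M)%N (leq_trans (leqW (leq_addl _ _)) (leq_addl _ _)).
have Eg : g (k + M).+2 = (e + g (k + M).+1)%N by apply: gS; rewrite /M; lia.
move: IHk E2 Eg (fE (k + M)%N) (fE (k + M).+1) (le M); rewrite addSn -/e.
by do 7! move: (colen _); move: (g _) (g _); lia.
Qed.

(* [V n] is the sum of the colons [(K^(n+1) : a t)] for [p] values of [t] such that [a t] is
   not superficial, and [alpha] is the product of these [a t]. *)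
Lemma sum_of_colons : ~ ev (fun t => superficial K (a t)) ->
  forall p, exists V alpha j v,
  [/\ (p <= v)%N, (K ^^ j) alpha,
      forall n, [/\ is_ideal (V n), K ^^ n `<=` V n,
         forall z, V n z -> (K ^^ (n + j)) (alpha * z)
       & forall y z, K y -> V n z -> V n.+1 (y * z)],
      ev (fun n => colen (K ^^ n) = colen (V n) + v)%N
    & ev (fun t => ev (fun n => forall z,
        (K ^^ n.+1) (a t * z) -> (K ^^ (n + j)) (alpha * z) -> (K ^^ n) z))].
Proof.
move=> /not_ev bad; elim=> [|p [V [alpha [j [v [pv Kal VP fV cop]]]]]].
  exists (fun n => K ^^ n), 1, 0%N, 0%N; split=> //.
  - move=> n; split=> // z; first by rewrite addn0 mul1r.
    by move=> y Kz; exact: mem_ideal_mul.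
  - by exists 0%N => n _; rewrite addn0.
  - by exists 0%N => t _; exists 0%N => n _ z _; rewrite addn0 mul1r.
have gjr := generic_joint_reduction noethR localR parR fK fK gKa gKa.
have [N NP] := ev_and cop gjr.
have [t [/NP[copt jrt] nsup]] := bad N.
pose x := a t; have Kx : K x by exact: gKa.1.
have [N' N'P] := jrt; have jr' := N'P N' (leqnn _).
have [eps epsP] := colen_colon_pow_const jr'.
have eps0 : (0 < eps)%N.
  rewrite lt0n; apply/eqP => eps0; apply: nsup; apply: ev_mono epsP => n.
  rewrite eps0 addn0 => E; apply/esym/colen_inj => //; last by rewrite E.
  by move=> z Kz; exact: mem_ideal_mul.
exists (fun n => V n <+> K ^^ n.+1 :% x), (alpha * x), j.+1, (v + eps)%N; split.
- by lia.
- by rewrite mulrC; exact: mem_ideal_mul.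
- move=> n; have [iV KV aV SV] := VP n; have [iV' _ _ _] := VP n.+1; split=> //.
  + by apply: subset_trans KV _; exact: sub_addl.
  + move=> _ [z Vz [w Ww <-]]; rewrite mulrDr; apply: idlD => //.
      by rewrite mulrAC mulrC addnS; apply: mem_ideal_mul => //; exact: aV.
    by rewrite -mulrA addnS -addSn mulrC; exact: ideal_pow_add.
  + move=> y _ Ky [z Vz [w Ww <-]]; rewrite mulrDr; exists (y * z); first exact: SV.
    exists (y * w) => //=; rewrite mulrCA; exact: mem_ideal_mul.
- apply: ev_mono (ev_and fV (ev_and epsP copt)) => n [E [E' coptn]].
  have [iV KV aV SV] := VP n.
  have fVn : fcol (V n) by exact: fcol_sub (fKn n) _ _.
  have fW : fcol (K ^^ n.+1 :% x).
    by apply: fcol_sub (fKn n) _ _ => // z Kz; exact: mem_ideal_mul.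
  have [_] := colen_modular fVn fW.
  (* Independence of the new colon: [alpha] sends V n into K^(n+j), so [copt] applies to the
     intersection. The lengths over K^n therefore add. *)
  have -> : V n `&` (K ^^ n.+1 :% x) = K ^^ n.
    apply/seteqP; split=> [z [Vz Wz]|z Kz]; first by apply: coptn => //; exact: aV.
    by split; [exact: KV | exact: mem_ideal_mul].
  by move: E E'; rewrite /x; do 4! move: (colen _); lia.
(* The old clause at n + 1 puts x z in K^(n+1); the joint reduction (x, a u) then puts z in K^n. *)
- apply: ev_mono (ev_and cop jrt) => u [[M MP] /joint_reduction_colon_pow[M' M'P]].
  exists (maxn M M') => n; rewrite geq_max => /andP[Mn M'n] z uz az.
  apply: M'P => //; apply: (MP n.+1); first exact: leqW.
    by rewrite mulrCA; exact: mem_ideal_mul.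
  by rewrite mulrA addSn -addnS.
Qed.

(** Since V (2n) contains x^n V n + c^n V n, whose colength is n^2 e + 2 colen (V n), the Hilbert
    polynomial of K gives v <= e_2(K). Non-superficial members beyond every index would make v
    exceed the absolute value of e_2(K). *)
Lemma generic_superficial : ev (fun t => superficial K (a t)).
Proof.
apply: contrapT => bad.
have [x [c jr]] := joint_reduction_exists noethR localR resR parR fK fK.
have [Kx Kc _] := jr; have fxc := joint_reduction_fcol noethR fK fK jr.
have [V [alpha [j [v [pv _ VP [N NP] _]]]]] := sum_of_colons bad `|hilbert_coef K 2|.+1.
have [N' N'P] := hilbert_coefP noethR localR resR parR fK.
have h0 := hilbert_coef0 noethR localR resR parR fK jr.
pose n := maxn N N'; have [iV KV _ _] := VP n; have [iV2 _ _ _] := VP (n + n)%N.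
have fV : fcol (V n) by exact: fcol_sub (fKn n) _ _.
have fV2 : fcol (V (n + n)%N) by have [? ? _ _] := VP (n + n)%N; exact: fcol_sub (fKn (n + n)) _ _.
have Vpow y z k : K y -> V n z -> V (n + k)%N (y ^+ k * z).
  move=> Ky Vz; elim: k => [|k IHk]; first by rewrite addn0 mul1r.
  by have [_ _ _ SV] := VP (n + k)%N; rewrite addnS exprS -mulrA; exact: SV.
have kxc : koszul (x ^+ n) (c ^+ n) by exact: (@joint_reduction_koszul _ _ noethR localR parR _ _
  _ _ fK fK jr).
have fxcn := fcol_pair_pow n n fxc.
have := colen_koszul kxc fxcn fV fV.
rewrite (@ideal_eqT _ (_ `&` _)) //; last first.
  by split=> /=; rewrite mulr1; apply: KV; exact: mem_ideal_pow.
rewrite colenT (colen_pair_pow noethR localR parR) // addn0 => E.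
have : (colen (V (n + n)%N) <= colen (x ^+ n *> V n <+> c ^+ n *> V n))%N.
  apply: colen_le => //; first exact: fcol_koszul_add.
  by apply: ideal_add_sub => // _ [z Vz <-]; exact: Vpow.
rewrite E; have Nn : (N <= n)%N := leq_maxl _ _; have N'n : (N' <= n)%N := leq_maxr _ _.
have := NP n Nn; have := NP (n + n)%N (leq_trans Nn (leq_addr _ _)).
have := N'P n N'n; have := N'P (n + n)%N (leq_trans N'n (leq_addr _ _)).
rewrite h0.
have b1 : (2 * 'C(n.+1, 2) = n.+1 * n)%N by rewrite -mul_bin_diag bin1.
have b2 : (2 * 'C((n + n).+1, 2) = (n + n).+1 * (n + n))%N by rewrite -mul_bin_diag bin1.
have -> : 'C((n + n).+1, 2) = (n * n + 2 * 'C(n.+1, 2))%N by nia.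
move: pv; clear; rewrite !PoszD !PoszM !mulrDr.
move: (colen _) (colen _) (colen _) (colen _) (colen _) (hilbert_coef _ _) (hilbert_coef _ _).
by move=> *; nia.
Qed.

End Superficial.

(** * Local cohomology of the extended Rees algebra *)

Section LocalCohomologyCriterion.
Variables (R : comNzRingType) (I J : set R) (a b : R).
Hypotheses (Ia : I a) (Jb : J b) (iI : is_ideal I) (iJ : is_ideal J).
Implicit Types (f g : ext_rees I J) (x y z c : R) (k n : nat).

Local Notation G := (int * int)%type.
Local Notation A := (rees_mono I J a 1 0).
Local Notation B := (rees_mono I J b 0 1).

Lemma galg_monoM c (d : G) (f : galg R G) e : (galg_mono c d * f) e = c * f (e - d).
Proof.
have [s cf] := galg_covers f.
rewrite [LHS](convolE e (galg_mono_covers c d) cf) big_seq1.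
under eq_bigr do rewrite /galg_mono_fun eqxx mulr1n.
have [ns|ns] := boolP (e - d \in s).
  rewrite (bigD1_seq (e - d)) ?(proj1 cf) //= [d + _]addrC subrK eqxx mulr1n.
  rewrite big1 ?addr0 // => j jn; case: eqP => // jE; case/eqP: jn.
  by rewrite -jE addrAC subrr add0r.
rewrite big1_seq => [|j /= js].
  have -> : f (e - d) = 0 by apply/eqP; apply: contraNT ns; exact: (proj2 cf).
  by rewrite mulr0.
by case: eqP => // jE; move: ns; rewrite -jE addrAC subrr add0r js.
Qed.

Lemma rees_val_mono c r s : ideal_mul (ideal_powz I r) (ideal_powz J s) c ->
  rees_val (rees_mono I J c r s) = galg_mono c (r, s).
Proof. by move=> IJc; rewrite /rees_mono [LHS]insubdK //; exact: rees_mono_mem. Qed.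

Lemma rees_valM f g : rees_val (f * g) = rees_val f * rees_val g.
Proof. exact: (rmorphM (\val : ext_rees I J -> galg R G)). Qed.

Lemma rees_monoM c r s f e : ideal_mul (ideal_powz I r) (ideal_powz J s) c ->
  (rees_mono I J c r s * f : ext_rees I J) e = c * f (e - (r, s)).
Proof. by move=> IJc; rewrite rees_valM rees_val_mono // galg_monoM. Qed.

Lemma rees_genM i j f (p q : int) :
  (A ^+ i * B ^+ j * f : ext_rees I J) (p, q) =
  a ^+ i * b ^+ j * f (p - i%:Z, q - j%:Z).
Proof.
have IJa : ideal_mul (ideal_powz I 1) (ideal_powz J 0) a.
  by rewrite /= !ideal_mulT.
have IJb : ideal_mul (ideal_powz I 0) (ideal_powz J 1) b.
  by rewrite /= ideal_Tmul // ideal_mulT.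
elim: i p q => [|i IHi] p q; last first.
  rewrite exprS -!mulrA rees_monoM // !mulrA IHi exprS -!mulrA; congr (_ * (_ * (_ * f _))).
  by congr pair => /=; lia.
elim: j p q => [|j IHj] p q; first by rewrite !mul1r !subr0.
have -> : A ^+ 0 * B ^+ j.+1 * f = B * (A ^+ 0 * B ^+ j * f) by rewrite exprS; ring.
rewrite rees_monoM // IHj !mul1r exprS -mulrA; congr (_ * (_ * f _)).
by congr pair => /=; lia.
Qed.

Lemma rees_coefP f (p q : int) : ideal_mul (ideal_powz I p) (ideal_powz J q) (f (p, q)).
Proof. by have /asboolP := valP f. Qed.

Lemma rees_valB f g e : (f - g : ext_rees I J) e = f e - g e.
Proof. by []. Qed.

Lemma rees_valD f g e : (f + g : ext_rees I J) e = f e + g e.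
Proof. by []. Qed.

Lemma cech_d1E g h p q :
  cech_d1 (loc_frac A g p, loc_frac B h q) =
  loc_frac (A * B) ((A * B) ^+ q * (g * B ^+ p) - (A * B) ^+ p * (h * A ^+ q)) (p + q).
Proof.
rewrite /cech_d1 /= (loc_mapE (erefl (A * B))) (loc_mapE (mulrC A B)).
rewrite [LHS](_ : _ = loc_add (loc_frac (A * B) (g * B ^+ p) p)
                     (loc_opp (loc_frac (A * B) (h * A ^+ q) q))) //.
by rewrite loc_oppE loc_addE mulrN.
Qed.

(** A class of degree (0, 0) is f / (AB)^k with f = x t1^k t2^k and x in I^k J^k. It vanishes when a
    multiple of f by a power of AB comes from the two partial localizations; only one bidegree has
    to be compared. *)
Lemma rees_H2_component0P :
  rees_H2 I J a b 0 0 = [set 0] <->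
  forall k x, (I ^^ k <**> J ^^ k) x -> exists n,
    (a ^+ (k + n) *> J ^^ (k + n) <+> b ^+ (k + n) *> I ^^ (k + n)) ((a * b) ^+ n * x).
Proof.
have deg (n : nat) : ((0, 0) + (1, 1) *+ n : G) = (n%:Z, n%:Z).
  rewrite add0r; elim: n => // n IHn; rewrite mulrS IHn.
  by congr pair => /=; lia.
have zeroP v : (\pi_(local_cohomology2 A B) v == 0) = (v \in @cech_B2 _ A B).
  by rewrite -[v in RHS]subr0 Quotient.idealrBE raddf0.
split.
  move=> H2 k x Xx.
  pose f := rees_mono I J x k k.
  have fx : rees_val f = galg_mono x (k%:Z, k%:Z) by rewrite rees_val_mono.
  have : rees_H2 I J a b 0 0 (\pi_(local_cohomology2 A B) (loc_frac (A * B) f k)).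
    exists k; exists f => // e; rewrite deg fx /= /galg_mono_fun => /negPf ->.
    by rewrite mulr0n.
  rewrite H2 => /eqP; rewrite zeroP => /asboolP[[u v] _].
  elim/loc_ind: u => g p; elim/loc_ind: v => h q.
  rewrite cech_d1E => /loc_fracP[l lE].
  (* In bidegree (k + n, k + n) this choice selects the coefficients of g at (p, 0) and of h at (0,
     q), which lie in I^p and J^q. *)
  pose n := (l + p + q)%N; exists n.
  have E : A ^+ (l + k + q) * B ^+ (k + n) * g - A ^+ (k + n) * B ^+ (l + k + p) * h
      - A ^+ n * B ^+ n * f = 0.
    by rewrite -[RHS]lE /n !exprD !exprMn; ring.
  have {E} : (A ^+ (l + k + q) * B ^+ (k + n) * g - A ^+ (k + n) * B ^+ (l + k + p) * h
      - A ^+ n * B ^+ n * f : ext_rees I J) ((k + n)%N%:Z, (k + n)%N%:Z) = 0 by rewrite E.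
  rewrite !rees_valB !rees_genM fx /= /galg_mono_fun.
  have -> : (k + n)%N%:Z - (l + k + q)%N%:Z = p%:Z by rewrite /n; lia.
  have -> : (k + n)%N%:Z - (l + k + p)%N%:Z = q%:Z by rewrite /n; lia.
  have -> : (k + n)%N%:Z - n%:Z = k%:Z by lia.
  rewrite subrr eqxx mulr1n => /eqP; rewrite subr_eq0 => /eqP E.
  have Ig : (I ^^ p) (g (p%:Z, 0)) by have := @rees_coefP g p%:Z 0; rewrite /= ideal_mulT.
  have Jh : (J ^^ q) (h (0, q%:Z)) by have := @rees_coefP h 0 q%:Z; rewrite /= ideal_Tmul.
  exists (a ^+ (k + n) * - (b ^+ (l + k + p) * h (0, q%:Z))).
    exists (- (b ^+ (l + k + p) * h (0, q%:Z))) => //; apply: idlN => //.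
    have -> : (k + n = l + k + p + q)%N by rewrite /n; lia.
    by apply: ideal_pow_add => //; exact: mem_ideal_pow.
  exists (b ^+ (k + n) * (a ^+ (l + k + q) * g (p%:Z, 0))).
    exists (a ^+ (l + k + q) * g (p%:Z, 0)) => //.
    have -> : (k + n = l + k + q + p)%N by rewrite /n; lia.
    by apply: ideal_pow_add => //; exact: mem_ideal_pow.
  by rewrite exprMn -E; ring.
move=> Hkx; apply/seteqP; split=> [u [n [f]]|_ ->]; last first.
  by exists 0%N; exists 0 => //; apply/esym/eqP; rewrite zeroP; exact: rpred0.
rewrite deg => hf ->; apply/eqP; rewrite zeroP.
have [j [_ [y Jy <-] [_ [z Iz <-] xE]]] := Hkx n _ (@rees_coefP f n%:Z n%:Z).
pose N := (n + j)%N.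
pose gz := rees_mono I J z N%:Z 0; pose gy := rees_mono I J y 0 N%:Z.
have gzE : rees_val gz = galg_mono z (N%:Z, 0) by rewrite rees_val_mono //= ideal_mulT.
have gyE : rees_val gy = galg_mono y (0, N%:Z) by rewrite rees_val_mono //= ideal_Tmul.
(* The sign compensates the difference in [cech_d1]. *)
apply/asboolP; exists (loc_frac A gz N, loc_frac B (- gy) N) => //.
rewrite cech_d1E; apply/loc_fracP; exists 0%N.
have E : A ^+ 0 * B ^+ N * gz + A ^+ N * B ^+ 0 * gy - A ^+ j * B ^+ j * f = 0.
  apply: val_inj; apply: galg_eqP => -[p q].
  rewrite [LHS](_ : _ = (A ^+ 0 * B ^+ N * gz + A ^+ N * B ^+ 0 * gy - A ^+ j * B ^+ j * f) (p,
    q)) //.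
  rewrite [RHS](_ : _ = 0) // rees_valB rees_valD !rees_genM gzE gyE /= /galg_mono_fun !subr0.
  have [[-> ->]|pqN] := eqVneq (p, q) (N%:Z, N%:Z).
    rewrite !subrr !eqxx !mulr1n.
    have -> : N%:Z - j%:Z = n%:Z by rewrite /N; lia.
    by rewrite -exprMn -xE /N; ring.
  rewrite !xpair_eqE !subr_eq0.
  have /negPf -> : ~~ ((p == N) && (q == N)) by apply: contra pqN => /andP[/eqP-> /eqP->].
  rewrite !mulr0n hf; first by rewrite !mulr0 !addr0 subrr.
  apply: contra pqN; rewrite !xpair_eqE => /andP[/eqP pE /eqP qE].
  by apply/andP; split; apply/eqP; rewrite /N; lia.
move: E; rewrite !mul1r !mulr1 => /(congr1 ( *%R ((A * B) ^+ (N + n)))).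
rewrite mulr0 => {}E; rewrite -[RHS]E /N !exprD !exprMn; ring.
Qed.

End LocalCohomologyCriterion.

(** * Comparison of the three conditions *)

Section Comparison.
Variables (R : comNzRingType) (m : set R).
Hypotheses (noethR : is_noetherian R) (localR : is_local m).
Hypothesis resR : infinite_residue_field m.
Hypothesis parR : exists x y,
  [/\ m x, m y, regular_pair x y & fcol (x *> [set: R] <+> y *> [set: R])].
Variables (I J : set R).
Hypotheses (fI : fcol I) (fJ : fcol J).
Implicit Types (a b x y z : R) (k n r s : nat).

Local Notation X p q := (I ^^ p <**> J ^^ q).
Local Notation L p q := (colen (X p q)).
Local Notation e_ a b := (colen (a *> [set: R] <+> b *> [set: R])).

Definition joint_defect0 a b := ev (fun k =>
  X k k = a ^+ k *> J ^^ k <+> b ^+ k *> I ^^ k).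

(** Since a^k lies in I^k and b^k in J^k, the colon term of [colen_koszul] is the unit ideal; D(k,k)
    is thus the length of the quotient of the two ideals. *)
Lemma joint_defect0P a b k : is_joint_reduction I J a b ->
  X k k = a ^+ k *> J ^^ k <+> b ^+ k *> I ^^ k <->
  (k * k * e_ a b + colen (I ^^ k) + colen (J ^^ k) = L k k)%N.
Proof.
move=> jr; have [Ia Jb _] := jr; have iI := fcol_ideal fI; have iJ := fcol_ideal fJ.
have := colen_joint_reduction_pow noethR localR parR fI fJ jr 0 0 k k.
rewrite (@ideal_eqT _ (_ `&` _)) //; last first.
  split=> /=; rewrite mulr1.
    by rewrite ideal_Tmul //; exact: mem_ideal_pow.
  by rewrite ideal_mulT //; exact: mem_ideal_pow.
rewrite colenT addn0 !add0n ideal_pow0_mul ideal_mul_pow0 => E.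
split=> [->|E']; first by rewrite E addnAC.
apply/esym/colen_inj => //.
- by apply: fcol_koszul_add; [exact/fcol_pair_pow/(joint_reduction_fcol noethR fI fJ jr) | exact:
  fcol_pow..].
- have := joint_reduction_pow_sub jr (p := 0) (q := 0) (r := k) (s := k).
  by rewrite !add0n ideal_pow0_mul ideal_mul_pow0.
- by rewrite E -E' addnAC.
Qed.

(** D >= 0 bounds e_(2,0) and e_(0,2) from above, and L(r,s) >= l(R/I^r), l(R/J^s) bound them from
    below, so they equal e_0(I) and e_0(J). The diagonal r = s identifies e_(0,0) with e_2(IJ). The
    remaining affine function is nonnegative, and letting one variable grow with the other fixed
    gives the sign of each coefficient. *)
Lemma hilbert_comparison a b : is_joint_reduction I J a b ->
  [/\ 0 <= bihilbert_coef I J 1%N 0%N - hilbert_coef I 1%N,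
      0 <= bihilbert_coef I J 0%N 1%N - hilbert_coef J 1%N & ev (fun k =>
    (k * k * e_ a b + colen (I ^^ k) + colen (J ^^ k))%N%:Z - (L k k)%:Z =
    (bihilbert_coef I J 1%N 0%N - hilbert_coef I 1%N
     + (bihilbert_coef I J 0%N 1%N - hilbert_coef J 1%N)) * k%:Z
    + (hilbert_coef I 2%N + hilbert_coef J 2%N - hilbert_coef (I <**> J) 2%N))].
Proof.
move=> jr; have fIJ := fcol_mul noethR fI fJ.
have := bihilbert_coef11 noethR localR resR parR fI fJ jr.
have := bihilbert_coefP noethR localR resR parR fI fJ.
have := hilbert_coefP noethR localR resR parR fI.
have := hilbert_coefP noethR localR resR parR fJ.
have := hilbert_coefP noethR localR resR parR fIJ.
set h := hilbert_coef (I <**> J); set hJ := hilbert_coef J; set hI := hilbert_coef I.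
set w := bihilbert_coef I J => -[N0 H] [N1 HJ] [N2 HI] [N3 W] w11.
have [N [MN0 MN1 MN2 MN3]] : exists N, [/\ N0 <= N, N1 <= N, N2 <= N & N3 <= N]%N.
  by exists (N0 + N1 + N2 + N3)%N; split; lia.
have ub r s : (L r s <= r * s * e_ a b + colen (J ^^ s) + colen (I ^^ r))%N.
  have := joint_reduction_pow_le noethR localR parR fI fJ jr 0 0 r s.
  by rewrite !add0n ideal_pow0_mul ideal_mul_pow0.
have lbI r s : (colen (I ^^ r) <= L r s)%N.
  by apply: colen_le; [exact: fcol_mul_pow | | exact: ideal_mul_subl].
have lbJ r s : (colen (J ^^ s) <= L r s)%N.
  by apply: colen_le; [exact: fcol_mul_pow | | exact: ideal_mul_subr].
have D r s : (N <= r)%N -> (N <= s)%N -> [/\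
    0 <= (hI 0%N - w 2%N 0%N) * 'C(r.+1, 2)%:Z + (w 1%N 0%N - hI 1%N) * r%:Z
       + ((hJ 0%N - w 0%N 2%N) * 'C(s.+1, 2)%:Z + (w 0%N 1%N - hJ 1%N) * s%:Z
       + (hI 2%N + hJ 2%N - w 0%N 0%N)),
    0 <= (w 2%N 0%N - hI 0%N) * 'C(r.+1, 2)%:Z + (w 1%N 1%N * s%:Z - w 1%N 0%N + hI 1%N) * r%:Z
       + (w 0%N 2%N * 'C(s.+1, 2)%:Z - w 0%N 1%N * s%:Z + w 0%N 0%N - hI 2%N) &
    0 <= (w 0%N 2%N - hJ 0%N) * 'C(s.+1, 2)%:Z + (w 1%N 1%N * r%:Z - w 0%N 1%N + hJ 1%N) * s%:Z
       + (w 2%N 0%N * 'C(r.+1, 2)%:Z - w 1%N 0%N * r%:Z + w 0%N 0%N - hJ 2%N)].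
  move=> Nr Ns.
  have := W r s (leq_trans MN3 Nr) (leq_trans MN3 Ns).
  have := HI r (leq_trans MN2 Nr); have := HJ s (leq_trans MN1 Ns).
  have := ub r s; have := lbI r s; have := lbJ r s.
  move: w11; move: (colen _) (colen _) (colen _) (colen _) => e lr ls lrs w11.
  rewrite w11 PoszM; move: ('C(_, _)) ('C(_, _)) => c1 c2.
  by move=> *; split; nia.
have w20 : w 2%N 0%N = hI 0%N.
  have : 0 <= hI 0%N - w 2%N 0%N.
    by apply: (@quadratic_ge0 _ _ _ N) => r Nr; have [+ _ _] := D r N Nr (leqnn _); exact.
  have : 0 <= w 2%N 0%N - hI 0%N.
    by apply: (@quadratic_ge0 _ _ _ N) => r Nr; have [_ + _] := D r N Nr (leqnn _); exact.
  by lia.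
have w02 : w 0%N 2%N = hJ 0%N.
  have : 0 <= hJ 0%N - w 0%N 2%N.
    apply: (@quadratic_ge0 _ (w 0%N 1%N - hJ 1%N) _ N) => s Ns.
    by have [+ _ _] := D N s (leqnn _) Ns; rewrite addrCA; exact.
  have : 0 <= w 0%N 2%N - hJ 0%N.
    by apply: (@quadratic_ge0 _ _ _ N) => s Ns; have [_ _ +] := D N s (leqnn _) Ns; exact.
  by lia.
have w00 : w 0%N 0%N = h 2%N.
  pose c := w 2%N 0%N + w 0%N 2%N + w 1%N 1%N + w 1%N 1%N - h 0%N.
  pose c1 := h 1%N - w 1%N 1%N - w 1%N 0%N - w 0%N 1%N.
  have Q n : (N <= n)%N -> c * 'C(n.+1, 2)%:Z + c1 * n%:Z + (w 0%N 0%N - h 2%N) = 0.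
    move=> Nn; have := W n n (leq_trans MN3 Nn) (leq_trans MN3 Nn).
    rewrite -ideal_mul_pow (H n (leq_trans MN0 Nn)).
    have -> : (n * n)%N%:Z = 'C(n.+1, 2)%:Z + 'C(n.+1, 2)%:Z - n%:Z.
      have : (2 * 'C(n.+1, 2) = n.+1 * n)%N by rewrite -mul_bin_diag bin1.
      by move: ('C(_, _)); nia.
    rewrite /c /c1; move: ('C(_, _)); nia.
  have c0 : c = 0.
    have : 0 <= c by apply: (@quadratic_ge0 c c1 (w 0%N 0%N - h 2%N) N) => n /Q ->.
    have : 0 <= - c.
      apply: (@quadratic_ge0 _ (- c1) (- (w 0%N 0%N - h 2%N)) N) => n /Q E.
      by rewrite !mulNr -!opprD E.
    by lia.
  have [|_] := @affine_eq0 c1 (w 0%N 0%N - h 2%N) N; last by lia.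
  by move=> n /Q; rewrite c0 mul0r add0r.
set alpha := w 1%N 0%N - hI 1%N; set beta := w 0%N 1%N - hJ 1%N.
set gamma := _ - h 2%N; split.
- apply: (@affine_ge0 _ (beta * N%:Z + gamma) N) => r Nr.
  by have [+ _ _] := D r N Nr (leqnn _); rewrite w20 w02 w00 !subrr !mul0r !add0r; exact.
- apply: (@affine_ge0 _ (alpha * N%:Z + gamma) N) => s Ns.
  by have [+ _ _] := D N s (leqnn _) Ns; rewrite w20 w02 w00 !subrr !mul0r !add0r addrCA; exact.
exists N => k Nk.
have := W k k (leq_trans MN3 Nk) (leq_trans MN3 Nk).
rewrite w11 w20 w02 w00 => ->.
have -> : (k * k * e_ a b + colen (I ^^ k) + colen (J ^^ k))%N%:Z =
    (k * k)%N%:Z * (e_ a b)%:Z + (colen (I ^^ k))%:Z + (colen (J ^^ k))%:Z.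
  by rewrite !PoszD PoszM.
rewrite (HI k (leq_trans MN2 Nk)) (HJ k (leq_trans MN1 Nk)) /alpha /beta /gamma.
ring.
Qed.

(** On the diagonal only the sum of the two linear coefficients must vanish; as both are
    nonnegative, each of them does. *)
Lemma joint_defect0_coefs a b : is_joint_reduction I J a b ->
  joint_defect0 a b <->
  [/\ bihilbert_coef I J 1%N 0%N = hilbert_coef I 1%N,
      bihilbert_coef I J 0%N 1%N = hilbert_coef J 1%N
    & hilbert_coef (I <**> J) 2%N = hilbert_coef I 2%N + hilbert_coef J 2%N].
Proof.
move=> jr; have [al0 be0 [N NP]] := hilbert_comparison jr.
split=> [[N' N'P]|[e1 e2 e3]].
  set c := _ - _ in al0; set c' := _ - _ in be0.
  set d := hilbert_coef I 2 + hilbert_coef J 2 - hilbert_coef (I <**> J) 2.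
  have [] : c + c' = 0 /\ d = 0; last by rewrite /d; split; lia.
  apply: (@affine_eq0 _ _ (maxn N N')) => n; rewrite geq_max => /andP[/NP <- N'n].
  by have /(joint_defect0P _ jr)-> := N'P n N'n; rewrite subrr.
exists N => k /NP E; apply/(joint_defect0P _ jr); move: E; rewrite e1 e2 e3 !subrr.
by move/eqP; rewrite subr_eq0 => /eqP[].
Qed.

(** A joint reduction of I^k and J^k need not consist of powers of a and b. Its multiplicity is
    still the mixed difference, with steps of size k, of the polynomial of (I, J). *)
Lemma joint_reduction_pow_multiplicity a b a' b' k : (0 < k)%N ->
  is_joint_reduction I J a b -> is_joint_reduction (I ^^ k) (J ^^ k) a' b' ->
  e_ a' b' = (k * k * e_ a b)%N.
Proof.
move=> k0 jr jr'.
have [N NP] := bihilbert_coefP noethR localR resR parR fI fJ.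
have w11 := bihilbert_coef11 noethR localR resR parR fI fJ jr.
have [N' N'P] := joint_reduction_difference noethR localR parR (fcol_pow noethR k fI) (fcol_pow
  noethR k fJ) jr'.
set n := maxn N N'; have [] := N'P n n (leq_maxr _ _) (leq_maxr _ _).
have Nn : (N <= k * n)%N by apply: leq_trans (leq_maxl N N') _; rewrite leq_pmull.
have Nn1 : (N <= k * n.+1)%N by rewrite mulnS; apply: leq_trans Nn (leq_addl _ _).
rewrite !ideal_powM.
have := NP _ _ Nn Nn; have := NP _ _ Nn1 Nn; have := NP _ _ Nn Nn1; have := NP _ _ Nn1 Nn1.
rewrite w11.
have -> : (k * n.+1 * (k * n.+1))%N%:Z = (k * n * (k * n))%N%:Z + (k * n * k)%N%:Z
  + (k * n * k)%N%:Z + (k * k)%N%:Z by lia.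
have -> : (k * n.+1 * (k * n))%N%:Z = (k * n * (k * n))%N%:Z + (k * n * k)%N%:Z by lia.
have -> : (k * n * (k * n.+1))%N%:Z = (k * n * (k * n))%N%:Z + (k * n * k)%N%:Z by lia.
rewrite !mulrDr.
have -> : (e_ a b)%:Z * (k * k)%N%:Z = (k * k * e_ a b)%N%:Z by rewrite -PoszM mulnC.
move=> + + + + + _; move: (k * k * _)%N; do 5! move: (colen _); lia.
Qed.

(** The numerical criterion does not depend on the joint reduction. *)
Lemma joint_defect0_transfer a b a' b' : is_joint_reduction I J a b ->
  is_joint_reduction I J a' b' -> joint_defect0 a b -> joint_defect0 a' b'.
Proof. by move=> jr jr' /(joint_defect0_coefs jr)/(joint_defect0_coefs jr'). Qed.

Lemma superficial_pow K x : superficial K x ->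
  exists N, forall k n z, (N <= k)%N -> (K ^^ (k + n)) (x ^+ n * z) -> (K ^^ k) z.
Proof.
move=> [N NP]; exists N => k n z Nk; elim: n z => [|n IHn] z; first by rewrite addn0 mul1r.
rewrite addnS exprS -mulrA => xz; apply: IHn.
by rewrite -NP // (leq_trans Nk) ?leq_addr.
Qed.

Lemma joint_defect0_limit a b : is_joint_reduction I J a b -> joint_defect0 a b ->
  forall k x, (X k k) x -> exists n,
    (a ^+ (k + n) *> J ^^ (k + n) <+> b ^+ (k + n) *> I ^^ (k + n)) ((a * b) ^+ n * x).
Proof.
move=> [Ia Jb _] [N NP] k x Xx; exists N; rewrite -NP ?leq_addl // addnC !ideal_powD.
rewrite ideal_mulACA; apply: mem_ideal_mul => //.
by rewrite exprMn; apply: mem_ideal_mul; exact: mem_ideal_pow.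
Qed.

(* For superficial [a] and [b] the limit defining the (0,0) component of the local
   cohomology has injective transition maps far out. *)
Lemma limit_joint_defect0 a b : is_joint_reduction I J a b ->
  superficial I a -> superficial J b ->
  (forall k x, (X k k) x -> exists n,
    (a ^+ (k + n) *> J ^^ (k + n) <+> b ^+ (k + n) *> I ^^ (k + n)) ((a * b) ^+ n * x)) ->
  joint_defect0 a b.
Proof.
move=> jr /superficial_pow[N NP] /superficial_pow[N' N'P] H; exists (maxn N N') => k.
rewrite geq_max => /andP[Nk N'k]; have [Ia Jb _] := jr.
apply/seteqP; split; last first.
  have := joint_reduction_pow_sub jr (p := 0) (q := 0) (r := k) (s := k).
  by rewrite !add0n ideal_pow0_mul ideal_mul_pow0.
move=> x /H[n [_ [y Jy <-] [_ [z Iz <-] xE]]].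
have kos r s : koszul (a ^+ r) (b ^+ s).
  exact: (joint_reduction_koszul noethR localR parR fI fJ jr).
(* Two Koszul relations cancel a^n and then b^n, with z = a^n t and y = b^n t'. Superficiality then
   puts t in I^k and t' in J^k. *)
have [|t [tE zE]] := kos n (k + n)%N (b ^+ n * x - a ^+ k * y) z.
  have -> : a ^+ n * (b ^+ n * x - a ^+ k * y) = (a * b) ^+ n * x - a ^+ (k + n) * y.
    by rewrite exprMn exprD; ring.
  by rewrite -xE addrC addKr.
have [|t' [t'E yE]] := koszul_sym (kos k n) (u := x - b ^+ k * t) (v := y).
  have -> : b ^+ n * (x - b ^+ k * t) = (b ^+ n * x - a ^+ k * y) - b ^+ (k + n) * t + a ^+ k * y.
    by rewrite exprD; ring.
  by rewrite tE subrr add0r.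
exists (a ^+ k * t'); first by exists t' => //; apply: (N'P _ n) => //; rewrite -yE.
exists (b ^+ k * t); first by exists t => //; apply: (NP _ n) => //; rewrite -zE.
by rewrite -t'E subrK.
Qed.

End Comparison.

(** * Joint reduction numbers of the powers *)

Section ReductionNumber.
Variables (R : comNzRingType) (m : set R).
Hypotheses (noethR : is_noetherian R) (localR : is_local m).
Hypothesis resR : infinite_residue_field m.
Hypothesis parR : exists x y,
  [/\ m x, m y, regular_pair x y & fcol (x *> [set: R] <+> y *> [set: R])].
Variables (I J : set R).
Hypotheses (fI : fcol I) (fJ : fcol J).

(** In one direction (a^k, b^k) is itself the joint reduction. In the other, reduction number zero
    for some (a', b') is a numerical equality involving only its multiplicity, which is k^2 times
    that of (a, b). *)
Lemma joint_defect0_reduction_number a b : is_joint_reduction I J a b ->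
  joint_defect0 I J a b <-> ev (fun k => joint_reduction_number0 (I ^^ k) (J ^^ k)).
Proof.
move=> jr; have [Ia Jb _] := jr; split=> -[N NP].
  exists N => k /NP E; exists (a ^+ k), (b ^+ k); split=> //.
  apply: (@joint_reduction_of_sub _ _ _ _ _ 0); [exact: mem_ideal_pow | exact: mem_ideal_pow |].
  by rewrite !ideal_pow1 // ideal_Tmul // ideal_mulT // E.
(* The multiplicity formula requires k > 0. *)
exists N.+1 => k Nk; apply/(joint_defect0P noethR localR parR fI fJ _ jr).
have [a' [b' [jr' E]]] := NP k (ltnW Nk).
have fIk := fcol_pow noethR k fI; have fJk := fcol_pow noethR k fJ.
have /(joint_defect0P noethR localR parR fIk fJk 1 jr') :
    (I ^^ k) ^^ 1 <**> (J ^^ k) ^^ 1 = a' ^+ 1 *> (J ^^ k) ^^ 1 <+> b' ^+ 1 *> (I ^^ k) ^^ 1.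
  by rewrite !ideal_pow1.
rewrite !ideal_pow1 // => <-; rewrite mul1n.
by rewrite (joint_reduction_pow_multiplicity noethR localR resR parR fI fJ _ jr jr') //; lia.
Qed.

End ReductionNumber.



Theorem corollary4p8 (R : comNzRingType) (m I J : set R)
    (hnoeth : is_noetherian R) (hloc : is_local m)
    (hCM : is_cohen_macaulay m) (hdim : has_krull_dim R 2)
    (hres : infinite_residue_field m)
    (hI : is_m_primary m I) (hJ : is_m_primary m J) :
  let stmt_a :=
    exists N, forall k, (N <= k)%N ->
      joint_reduction_number0 (ideal_pow I k) (ideal_pow J k) in
  let stmt_b :=
    [/\ bihilbert_coef I J 1%N 0%N = hilbert_coef I 1%N,
        bihilbert_coef I J 0%N 1%N = hilbert_coef J 1%N
      & hilbert_coef (ideal_mul I J) 2%N =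
          hilbert_coef I 2%N + hilbert_coef J 2%N] in
  let stmt_c :=
    forall a b : R, is_joint_reduction I J a b ->
      rees_H2 I J a b 0 0 = [set 0] in
  (stmt_a <-> stmt_b) /\ (stmt_b <-> stmt_c).
Proof.
move=> stmt_a stmt_b stmt_c.
have par := regular_parameters hnoeth hloc hCM hdim.
have m_primary_fcol Q : is_m_primary m Q -> fcol Q.
  by move=> [[iQ _ _] radQ]; apply: (fcol_radical hnoeth hloc) => // x; rewrite -radQ.
have fI := m_primary_fcol _ hI; have fJ := m_primary_fcol _ hJ.
have iI := fcol_ideal fI; have iJ := fcol_ideal fJ.
have [a ga] := generating_exists hnoeth hloc hres iI.
have [b gb] := generating_exists hnoeth hloc hres iJ.
(* The index for [b] is chosen after the one for [a], since the threshold for a joint reduction may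
   depend on the first element. *)
have [N NP] := ev_and (generic_superficial hnoeth hloc hres par fI ga)
                      (generic_joint_reduction hnoeth hloc par fI fJ ga gb).
have [supa jra] := NP N (leqnn _).
have [N' N'P] := ev_and (generic_superficial hnoeth hloc hres par fJ gb) jra.
have [supb jr] := N'P N' (leqnn _).
have defect_b := joint_defect0_coefs hnoeth hloc hres par fI fJ jr.
have defect_a := joint_defect0_reduction_number hnoeth hloc hres par fI fJ jr.
have defect_c : joint_defect0 I J (a N) (b N') <-> stmt_c.
  split=> [def0 x y jrxy|c].
    have [Ix Jy _] := jrxy; apply/(rees_H2_component0P Ix Jy iI iJ).
    apply: (joint_defect0_limit jrxy).
    exact: (joint_defect0_transfer hnoeth hloc hres par fI fJ jr jrxy def0).
  have [Ia Jb _] := jr; have /(rees_H2_component0P Ia Jb iI iJ) := c _ _ jr.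
  exact: (limit_joint_defect0 hnoeth hloc par fI fJ jr supa supb).
split; first exact: iff_trans (iff_sym defect_a) defect_b.
exact: iff_trans (iff_sym defect_b) defect_c.
Qed.
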